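(* Given $p\ge 1$, let $\mu\in\mathcal{P}_p(\mathbb{R})$ be an atomless measure. Define $h(x):=F_\mu^{-1}\circ F_{\eta_0}(x)$, $x\in\mathbb{R}$, and let $\xi^h_t:=h_{\#}\eta_t$, $t\in[0,1]$, be the associated canonical-time Bass MVM. Then $\xi^h$ minimises, simultaneously for all (measurable) weight functions $w:[0,1]\to[0,\infty)$, $$\mathbb{E}\left[\int_0^1 w(t)\,\mathcal{W}_p^p(\eta_t,\xi_t)\,\mathrm{d}t\right]$$ over all measure-valued martingales $\xi$ with $\xi_0=\mu$.
   Context: Fix a filtered probability space $(\Omega,\mathcal{F},(\mathcal{F}_t),\mathbb{P})$ satisfying the usual conditions and supporting a one-dimensional $(\mathcal{F}_t)$-Brownian motion $B$ with $B_0=0$. For $p\ge 1$, $\mathcal{P}_p(\mathbb{R})$ is the set of Borel probability measures $\mu$ on $\mathbb{R}$ with $\int|x|^p\mu(\mathrm{d}x)<\infty$. A measure-valued martingale (MVM) is an adapted process $(\xi_t)$ with $\xi_t\in\mathcal{P}_1(\mathbb{R})$ such that $\xi_t(f)=\int f\,\mathrm{d}\xi_t$ is a martingale for every $f\in C_b(\mathbb{R})$. When $\xi_0\in\mathcal{P}_p$, one takes the version that is càdlàg in the topology induced by $\mathcal{W}_p$. $\eta_t:=\mathrm{Law}(B_1\mid\mathcal{F}_t)=\mathcal{N}(B_t,1-t)$, $t\in[0,1]$ (so $\eta_0=\mathcal{N}(0,1)$). $F_\nu$ is the cumulative distribution function of $\nu$, $F_\nu^{-1}$ its (generalised) inverse,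 and $h_\#\nu$ is the pushforward of $\nu$ by $h$. With $h=F_\mu^{-1}\circ F_{\eta_0}$ one has $h_\#\eta_0=\mu$, and $\xi^h_t=h_\#\eta_t=\mathrm{Law}(h(B_1)\mid\mathcal{F}_t)$ is an MVM with $\xi^h_0=\mu$. $\mathcal{W}_p^p(\lambda,\mu)=\inf\int|x_1-x_2|^p\,\mathrm{d}\nu(x_1,x_2)$, the infimum being over probability measures $\nu$ on $\mathbb{R}\times\mathbb{R}$ with marginals $\lambda$ and $\mu$. *)

(* Defs.v *)
From HB Require Import structures.
From mathcomp Require Import all_boot all_order all_algebra.
From mathcomp Require Import all_classical all_reals all_analysis.
From mathcomp Require Import measurable_realfun.

Set Implicit Arguments.
Unset Strict Implicit.
Unset Printing Implicit Defensive.

Import Order.TTheory GRing.Theory Num.Theory.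
Import numFieldNormedType.Exports.

Local Open Scope classical_set_scope.
Local Open Scope ring_scope.

(* Processes are functions [R -> T -> E] and filtrations are functions
   [R -> set (set T)]; the time set is [0, 1] and values at other times are
   never used.  Elements of [probability] also assign (unconstrained) values to
   non-measurable sets, so equality of probability measures is always equality
   on measurable sets. *)

Section measures_on_the_line.
Context {R : realType}.
Local Notation Rm := (measurableTypeR R).
Implicit Types lam mu nu : probability Rm R.

Definition finite_moment (p : R) mu : Prop :=
  (\int[mu]_x (`|x| `^ p)%:E < +oo)%E.

Definition no_atom mu : Prop := forall x : R, mu [set x] = 0%E.

Definition coupling lam mu : set (probability (Rm * Rm)%type R) :=
  [set pi | forall A : set Rm, measurable A ->
     pi (A `*` setT) = lam A /\ pi (setT `*` A) = mu A].

(* The p-th power of the Wasserstein distance *)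
Definition wasserstein_pow (p : R) lam mu : \bar R :=
  ereal_inf [set (\int[pi]_z (`|z.1 - z.2| `^ p)%:E)%E | pi in coupling lam mu].

Definition wasserstein (p : R) lam mu : \bar R :=
  poweR (wasserstein_pow p lam mu) p^-1.

Definition id_RV : Rm -> R := idfun.

HB.instance Definition _ :=
  @isMeasurableFun.Build _ _ _ _ id_RV (@measurable_id _ _ setT).

Definition cdf_of nu (x : R) : R := fine (cdf (id_RV : {RV nu >-> R}) x).

(* The left-continuous generalised inverse of the cdf; meaningful for u in
   ]0, 1[ (the convention [inf set0 = 0] plays a role only outside). *)
Definition quantile nu (u : R) : R := inf [set x : R | u <= cdf_of nu x].

Lemma cdf_of_ge0 nu x : 0 <= cdf_of nu x.
Proof. by rewrite fine_ge0// cdf_ge0. Qed.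

Lemma cdf_of_le1 nu x : cdf_of nu x <= 1.
Proof. by rewrite -lee_fin fineK ?fin_num_measure// cdf_le1. Qed.

Lemma nondecreasing_cdf_of nu : nondecreasing_fun (cdf_of nu).
Proof.
by move=> x y xy; rewrite fine_le ?fin_num_measure// cdf_nondecreasing.
Qed.

Lemma measurable_cdf_of nu : measurable_fun [set: Rm] (cdf_of nu : Rm -> Rm).
Proof. by apply: nondecreasing_measurable => //; exact: nondecreasing_cdf_of. Qed.

Lemma nondecreasing_quantile nu (u v : R) :
  0 < u -> u <= v -> v < 1 -> quantile nu u <= quantile nu v.
Proof.
move=> u0 uv v1; apply: lb_le_inf.
  have /fine_cvg cv := cvg_cdfy1 (id_RV : {RV nu >-> R}).
  have [x /= /ltW ux] : exists x, v < cdf_of nu x.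
    exact: (filter_ex (cvgr_gt _ cv _ v1)).
  by exists x.
move=> x /= vx; apply: ge_inf; last exact: le_trans vx.
have /fine_cvg cv := cvg_cdfNy0 (id_RV : {RV nu >-> R}).
have [y /= yu] : exists y, cdf_of nu y < u.
  exact: (filter_ex (cvgr_lt _ cv _ u0)).
exists y => z /= uz; rewrite leNgt; apply/negP => /ltW zy.
by have := lt_le_trans yu uz; rewrite ltNge nondecreasing_cdf_of.
Qed.

Lemma quantile_le0 nu (u : R) : u <= 0 -> quantile nu u = 0.
Proof.
move=> u0; apply: inf_out => -[_ [l]] /(_ (l - 1)).
rewrite /= (le_trans u0) ?cdf_of_ge0// => /(_ isT).
by rewrite lerDl oppr_ge0 ler10.
Qed.

Lemma quantile_gt1 nu (u : R) : 1 < u -> quantile nu u = 0.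
Proof.
move=> u1; apply: inf_out => -[[x /=]].
by rewrite leNgt (le_lt_trans (cdf_of_le1 nu x) u1).
Qed.

Lemma measurable_quantile nu : measurable_fun [set: Rm] (quantile nu : Rm -> Rm).
Proof.
have -> : [set: R] = `]-oo, 0] `|` (`]0, 1[ `|` ([set 1] `|` `]1, +oo[)).
  apply/esym; rewrite -subTset => x _ /=; rewrite !in_itv/= andbT.
  have [?|x0] := leP x 0; first by left.
  by have [?|?|->] := ltgtP x 1; right; [left|right; right|right; left].
apply/measurable_funU => //; first by do 2 apply: measurableU => //.
split.
  apply: (@eq_measurable_fun _ _ Rm Rm _ (cst 0)) => // x.
  by rewrite inE/= in_itv/= => x0; rewrite quantile_le0.
apply/measurable_funU => //; first exact: measurableU.
split; last first.
  apply/measurable_funU => //; split; first exact: measurable_fun_set1.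
  apply: (@eq_measurable_fun _ _ Rm Rm _ (cst 0)) => // x.
  by rewrite inE/= in_itv/= andbT => x1; rewrite quantile_gt1.
apply: (measurability (@RGenCInfty.G R)) => [|/= _ [_] [r] -> <-].
  exact: RGenCInfty.measurableE.
apply: is_interval_measurable => s t/=.
rewrite !in_itv/= !andbT => -[/andP[s0 s1] rs] [/andP[t0 t1] _] u /andP[su ut].
split; first by rewrite in_itv/= (lt_le_trans s0 su) (le_lt_trans ut t1).
by rewrite in_itv/= andbT (le_trans rs)// nondecreasing_quantile//
   (le_lt_trans ut).
Qed.

Definition bass_map mu (x : Rm) : Rm :=
  quantile mu (cdf_of (normal_prob 0 1) x).

Lemma measurable_bass_map mu : measurable_fun [set: Rm] (bass_map mu).
Proof.
exact: measurableT_comp (measurable_quantile mu) (measurable_cdf_of _).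
Qed.

HB.instance Definition _ mu :=
  @isMeasurableFun.Build _ _ _ _ (bass_map mu) (measurable_bass_map mu).

End measures_on_the_line.

Section processes.
Context {R : realType} {d : measure_display} {T : measurableType d}.
Variables (P : probability T R) (F : R -> set (set T)).
Local Notation Rm := (measurableTypeR R).

Definition filtration : Prop :=
  (forall t, 0 <= t <= 1 ->
     sigma_algebra [set: T] (F t) /\ F t `<=` measurable) /\
  (forall s t, 0 <= s -> s <= t -> t <= 1 -> F s `<=` F t).

(* [P.-negligible] sets need not be measurable a priori: together with
   [filtration], the first clause also makes P complete. *)
Definition usual_conditions : Prop :=
  P.-negligible `<=` F 0 /\
  (forall t, 0 <= t < 1 -> F t = \bigcap_(s in `]t, 1]) F s).

Definition adapted d' (E : measurableType d') (X : R -> T -> E) : Prop :=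
  forall t, 0 <= t <= 1 -> forall U : set E, measurable U -> F t (X t @^-1` U).

Definition martingale (M : R -> T -> R) : Prop :=
  [/\ adapted (M : R -> T -> Rm),
      (forall t, 0 <= t <= 1 -> P.-integrable [set: T] (EFin \o M t)) &
      (forall s t, 0 <= s -> s <= t -> t <= 1 -> forall A, F s A ->
        (\int[P]_(o in A) (M t o)%:E = \int[P]_(o in A) (M s o)%:E)%E)].

Definition increment (B : R -> T -> R) (s t : R) (o : T) : Rm := B t o - B s o.

Definition brownian_motion (B : R -> T -> R) : Prop :=
  [/\ adapted (B : R -> T -> Rm),
      (forall o, B 0 o = 0),
      {ae P, forall o, {within `[0, 1], continuous (B ^~ o)}},
      (forall s t, 0 <= s -> s < t -> t <= 1 -> forall U : set Rm, measurable U ->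
        P (increment B s t @^-1` U) = normal_prob 0 (Num.sqrt (t - s)) U) &
      (forall s t, 0 <= s -> s < t -> t <= 1 ->
        forall A (U : set Rm), F s A -> measurable U ->
        P (A `&` increment B s t @^-1` U) = (P A * P (increment B s t @^-1` U))%E)].

(* [pprobability] carries the sigma-algebra generated by the evaluations
   [m |-> m A], which on P_1(R) is the Borel sigma-algebra of both the weak
   and the W_1 topology. *)
Definition measure_valued_martingale (xi : R -> T -> probability Rm R) : Prop :=
  [/\ adapted (xi : R -> T -> pprobability Rm R),
      (forall t o, 0 <= t <= 1 -> finite_moment 1 (xi t o)) &
      (forall f : R -> R, continuous f -> (exists K, forall x, `|f x| <= K) ->
        martingale (fun t o => \int[xi t o]_(x in [set: Rm]) f x))].

Definition cadlag_wasserstein (p : R) (m : R -> probability Rm R) : Prop :=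
  [/\ (forall t, 0 <= t <= 1 -> finite_moment p (m t)),
      (forall t, 0 <= t < 1 -> wasserstein p (m s) (m t) @[s --> t^'+] --> 0%E) &
      (forall t, 0 < t <= 1 -> exists2 l : probability Rm R, finite_moment p l &
        wasserstein p (m s) l @[s --> t^'-] --> 0%E)].

(* Measure-valued martingales started at mu, in their W_p-cadlag version *)
Definition mvm_from (p : R) (mu : probability Rm R)
    (xi : R -> T -> probability Rm R) : Prop :=
  [/\ measure_valued_martingale xi,
      {ae P, forall o, cadlag_wasserstein p (xi ^~ o)} &
      {ae P, forall o, forall A : set Rm, measurable A -> xi 0 o A = mu A}].

(* The conditional law N(B_t, 1 - t) of B_1 given F_t; it is spelled out at
   t = 1 because [normal_prob m 0] is not the Dirac mass at m. *)
Definition eta (B : R -> T -> R) (t : R) (o : T) : probability Rm R :=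
  if t < 1 then normal_prob (B t o) (Num.sqrt (1 - t)) : probability Rm R
  else \d_(B 1 o : Rm) : probability Rm R.

(* [distribution m X] is the pushforward of m by X *)
Definition bass_mvm (mu : probability Rm R) (B : R -> T -> R) (t : R) (o : T) :
    probability Rm R :=
  distribution (eta B t o) (bass_map mu).

Definition weighted_cost (p : R) (w : R -> R)
    (zeta xi : R -> T -> probability Rm R) : \bar R :=
  (\int[P]_o \int[lebesgue_measure]_(t in `[0%R, 1%R])
     ((w t)%:E * wasserstein_pow p (zeta t o) (xi t o)))%E.

End processes.

(* Main.v *)
(* Write gam = N(0,1) and h for the Bass map, so that h is nondecreasing and
   pushes gam to mu, and let C be the integral of |z - h z|^p against gam.

   Upper bound: eta_t and the Bass MVM are the laws of X and h(X) for
   X ~ N(B_t, 1 - t), hence W_p^p(eta_t, xi_t^h) <= E[|B_1 - h(B_1)|^p | F_t],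
   whose mean is C for every t.

   Lower bound: monotone rearrangement is optimal for W_p^p(gam, mu), and this is
   certified by bounded Lipschitz potentials phi, psi with
   phi x + psi y <= |x - y|^p whose dual value is at least the integral of
   |clip_N z - clip_N (h z)|^p. For an MVM xi started at mu, both eta_t(phi) and
   xi_t(psi) are martingales, so E W_p^p(eta_t, xi_t) >= gam(phi) + mu(psi) for
   every t; letting N tend to infinity gives E W_p^p(eta_t, xi_t) >= C. Since
   t |-> W_p^p(eta_t, xi_t) is not known to be jointly measurable, Tonelli is
   applied only to (eta_t(phi) + xi_t(psi))^+, which is.

   That xi^h is W_p-cadlag follows from the continuity of B, the continuity of h
   off a countable set and Doob's maximal inequality for the tails of h. *)
From HB Require Import structures.
Require Import Defs.
From mathcomp Require Import all_boot all_order all_algebra.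
From mathcomp Require Import all_classical all_reals all_analysis.
From mathcomp Require Import measurable_realfun ring lra.

Set Implicit Arguments.
Unset Strict Implicit.
Unset Printing Implicit Defensive.

Import Order.TTheory GRing.Theory Num.Theory.
Import numFieldNormedType.Exports.

Local Open Scope classical_set_scope.
Local Open Scope ring_scope.

(** * Integration and Gaussian preliminaries *)

(** Both bounds have the form [weight * C] in the extended reals, so the comparison needs no
    finiteness of the weight. The regularity asked of the potentials is dictated by what an MVM
    offers. Only [xi_t(f)] with f bounded continuous is a martingale, so the potentials must be
    bounded; the optimal ones for [|x - y| ^ p] may not be, hence the truncation at N. The Lipschitz
    property turns W_p-cadlag paths of measures into right-continuous real paths t |-> [xi_t(psi)],
    on which joint measurability rests. Clipping is monotone and nonexpansive: the clipped map is
    still monotone, and an inequality [phi + psi <= cost] between clipped points survives for the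
    points themselves. Every law N(B_t, 1 - t) is written as the image of [gam] under z |-> B_t +
    sqrt(1 - t) z. Thus [eta_t] and the Bass MVM live on one probability space, which provides the
    coupling; the Dirac mass at time 1 fits the same formula; and continuity in time becomes
    convergence for fixed z. *)

Section nonmeasurable_monotonicity.
Local Open Scope ereal_scope.
Context d (T : measurableType d) (R : realType).
Variable mu : {measure set T -> \bar R}.
Import HBNNSimple.

(* Neither integrand has to be measurable: the integral of a nonnegative
   function is a supremum over simple functions below it. *)
Lemma le_integral_ae_nonmeasurable (D N : set T) (f g : T -> \bar R) :
  measurable N -> mu N = 0 ->
  (forall x, D x -> 0 <= f x) -> (forall x, D x -> 0 <= g x) ->
  (forall x, D x -> ~ N x -> f x <= g x) ->
  \int[mu]_(x in D) f x <= \int[mu]_(x in D) g x.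
Proof.
move=> mN N0 f0 g0 fg; rewrite !ge0_integralE//.
apply: ge_ereal_sup => _ [h/= hf] <-.
have mNC : measurable (~` N) by exact: measurableC.
(* Killing the simple function on N puts it below g everywhere, on N because g is nonnegative, and
   keeps its integral because N is null. *)
pose h' := proj_nnsfun h mNC.
have h'E x : h' x = (h x * \1_(~` N) x)%R by rewrite /h'/= mindicE.
apply: (@le_trans _ _ (sintegral mu h')); last first.
  apply: ereal_sup_ubound; exists h' => // x; rewrite [h' x]h'E patchE.
  have [Nx|Nx] := pselect (N x).
    rewrite indicE memNset; last by move=> /(_ Nx).
    by rewrite mulr0; case: ifPn => // /[!inE] /g0.
  rewrite indicE mem_set// mulr1.
  apply: le_trans (hf x) _; rewrite patchE; case: ifPn => // /[!inE] Dx.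
  exact: fg.
rewrite -!integralT_nnsfun.
apply: ae_ge0_le_integral => //.
- by move=> x _; rewrite lee_fin.
- exact/measurable_EFinP.
- by move=> x _; rewrite lee_fin.
- exact/measurable_EFinP.
exists N; split => // x /=; apply: contra_notP => Nx _.
by rewrite /h'/= mindicE mem_set// mulr1.
Qed.

End nonmeasurable_monotonicity.

Section affine_images.
Context {R : realType}.
Local Notation Rm := (measurableTypeR R).
Local Notation leb := (@lebesgue_measure R).

Definition aff (b s : R) (z : Rm) : Rm := b + s * z.

Lemma measurable_aff b s : measurable_fun [set: Rm] (aff b s).
Proof. by apply: measurable_funD => //; apply: measurable_funM. Qed.

HB.instance Definition _ b s :=
  @isMeasurableFun.Build _ _ _ _ (aff b s) (measurable_aff b s).

Lemma lebesgue_measure_aff (b s : R) (A : set Rm) : 0 < s -> measurable A ->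
  leb A = (s%:E * leb (aff b s @^-1` A))%E.
Proof.
move=> s0 mA.
pose s' : {nonneg R} := NngNum (ltW s0).
have -> : (s%:E * leb (aff b s @^-1` A))%E =
    mscale s' (pushforward leb (aff b s)) A by [].
apply: lebesgue_measure_unique => //= _ [[x y] _ <-].
rewrite /mscale/= /pushforward.
have -> : aff b s @^-1` `]x, y]%classic = `](x - b) / s, (y - b) / s]%classic.
  apply/seteqP; split => z /=; rewrite !in_itv/= /aff.
    by rewrite ltr_pdivrMr// ler_pdivlMr// ltrBlDl lerBrDl (mulrC z).
  by rewrite ltr_pdivrMr// ler_pdivlMr// ltrBlDl lerBrDl (mulrC z).
rewrite !lebesgue_measure_itv/= !lte_fin.
rewrite ltr_pM2r ?invr_gt0// ltrD2r; case: ifPn => _; last by rewrite mule0.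
rewrite -!EFinB -EFinM; congr EFin; field; exact: lt0r_neq0.
Qed.

Lemma ge0_integral_aff (b s : R) (f : R -> \bar R) : 0 < s ->
  measurable_fun [set: Rm] f -> (forall x, 0 <= f x)%E ->
  (\int[leb]_x f x = s%:E * \int[leb]_z f (aff b s z))%E.
Proof.
move=> s0 mf f0; pose s' : {nonneg R} := NngNum (ltW s0).
unshelve epose (m := (pushforward leb (aff b s) : {measure set Rm -> \bar R})).
  exact: measurable_aff.
transitivity (\int[mscale s' m]_x f x)%E.
  by apply: eq_measure_integral => A mA _; exact: lebesgue_measure_aff.
by rewrite ge0_integral_mscale//= ge0_integral_pushforward.
Qed.

Lemma normal_prob_aff (b s : R) (A : set Rm) : 0 < s -> measurable A ->
  normal_prob b s A = normal_prob 0 1 (aff b s @^-1` A).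
Proof.
move=> s0 mA; rewrite /normal_prob.
rewrite integral_mkcond (@ge0_integral_aff b s)//; first last.
- move=> x; rewrite patchE; case: ifPn => // _.
  by rewrite lee_fin normal_pdf_ge0.
- apply/(measurable_restrictT _ _).1 => //.
  by apply/measurable_EFinP/measurable_funTS; exact: measurable_normal_pdf.
rewrite [RHS]integral_mkcond -ge0_integralZl//; last 3 first.
- apply: (measurableT_comp _ (measurable_aff b s)).
  apply/(measurable_restrictT _ _).1 => //.
  by apply/measurable_EFinP/measurable_funTS; exact: measurable_normal_pdf.
- move=> x _; rewrite patchE; case: ifPn => // _.
  by rewrite lee_fin normal_pdf_ge0.
- by rewrite lee_fin ltW.
apply: eq_integral => z _; rewrite !patchE.
have -> : (z \in aff b s @^-1` A) = (aff b s z \in A).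
  by apply/idP/idP; rewrite !inE.
case: ifPn => _; last by rewrite mule0.
rewrite -EFinM; congr EFin.
have s0' : s != 0 by exact: lt0r_neq0.
rewrite !normal_pdfE ?oner_neq0// mulrA; congr (_ * _).
  rewrite /normal_peak expr1n mul1r -mulrnAr sqrtrM ?sqr_ge0//.
  by rewrite sqrtr_sqr gtr0_norm// invfM mulrA divff// mul1r.
by rewrite /normal_fun /aff; congr expR; field.
Qed.

End affine_images.

Section monotone_functions.
Context {R : realType}.

(** A jump at x leaves a rational q strictly between [f x] and a one-sided limit, and then x is the
    point [c q] where f crosses the level q. When the set defining [c q] is empty or unbounded,
    [sup] returns a default value, but then f stays on one side of q and nothing is to be shown. *)
Lemma nondecreasing_continuous_off_countable (f : R -> R) :
  nondecreasing_fun f ->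
  exists2 C : set R, countable C & forall x, ~ C x -> f y @[y --> x] --> f x.
Proof.
move=> ndf.
pose c (q : rat) := sup [set x | f x < ratr q].
exists (range c); first by apply: sub_countable (card_image_le _ _) _; exact: countableP.
move=> x xC; apply/cvgrPdist_lt => e e0.
have fxe : f x - e < f x by rewrite ltrBlDr ltrDl.
have fxe' : f x < f x + e by rewrite ltrDl.
have [q] := rat_in_itvoo fxe; rewrite in_itv/= => /andP[q1 q2].
have [r] := rat_in_itvoo fxe'; rewrite in_itv/= => /andP[r1 r2].
have near_low : \forall y \near x, ratr q <= f y.
  have [[y0 fy0]|noy] := pselect (exists y0, f y0 < ratr q); last first.
    by near=> y; rewrite leNgt; apply/negP => ?; apply: noy; exists y.
  have xub : ubound [set x | f x < ratr q] x.
    move=> z /= fz; rewrite leNgt; apply/negP => /ltW /ndf fxz.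
    by have := lt_trans (le_lt_trans fxz fz) q2; rewrite ltxx.
  have cx : c q < x.
    rewrite lt_neqAle; apply/andP; split; last by apply: ge_sup => //; exists y0.
    by apply/eqP => cqx; apply: xC; exists q.
  near=> y; rewrite leNgt; apply/negP => fy.
  have : y <= c q by apply: ub_le_sup => //; exists x.
  by apply/negP; rewrite -ltNge; near: y; exact: lt_nbhsr.
have near_up : \forall y \near x, f y < ratr r.
  have [[y0 fy0]|noy] := pselect (exists y0, ratr r <= f y0); last first.
    by near=> y; rewrite ltNge; apply/negP => ?; apply: noy; exists y.
  have hub : has_ubound [set x | f x < ratr r].
    exists y0 => z /= fz; rewrite leNgt; apply/negP => /ltW /ndf fyz.
    by have := le_lt_trans (le_trans fy0 fyz) fz; rewrite ltxx.
  have cx : x < c r.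
    rewrite lt_neqAle; apply/andP; split; last exact: ub_le_sup.
    by apply/eqP => xcr; apply: xC; exists r.
  have [z fz xz] := sup_gt (ex_intro _ x r1 : [set x | f x < ratr r] !=set0) cx.
  near=> y; apply: le_lt_trans fz; apply: ndf; apply: ltW.
  by near: y; exact: lt_nbhsl.
near=> y; rewrite ltr_norml; apply/andP; split.
  rewrite ltrBrDl ltrBlDr; apply: lt_trans r2.
  by near: y.
rewrite ltrBlDl -ltrBlDr; apply: (lt_le_trans q1).
by near: y.
Unshelve. all: by end_near. Qed.

End monotone_functions.

Section real_probabilities.
Context {R : realType}.
Local Notation Rm := (measurableTypeR R).
Local Open Scope ereal_scope.

Lemma cdf_ofE (nu : probability Rm R) x : (cdf_of nu x)%:E = nu `]-oo, x]%classic.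
Proof. by rewrite /cdf_of fineK// fin_num_measure. Qed.

Lemma probability_unique_ray (m1 m2 : probability Rm R) :
  (forall x, m1 `]-oo, x]%classic = m2 `]-oo, x]%classic) ->
  forall A : set Rm, measurable A -> m1 A = m2 A.
Proof.
move=> m12; have G12 (x : R) : m1 `]x, +oo[%classic = m2 `]x, +oo[%classic.
  have -> : `]x, +oo[%classic = ~` `]-oo, x]%classic by rewrite setCitvl.
  by rewrite !probability_setC// m12.
move=> A mA.
apply: (@measure_unique _ R Rm (@RGenOInfty.G R) (fun n => `](- n%:R)%R, +oo[%classic)).
- exact: RGenOInfty.measurableE.
- move=> _ _ [x ->] [y ->]; exists (Num.max x y).
  apply/seteqP; split => z /=; rewrite !in_itv/= !andbT gt_max.
    by case=> -> ->.
  by move=> /andP.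
- by move=> n; exists (- n%:R)%R.
- apply/seteqP; split => // x _; exists (Num.truncn `|x|).+1 => //=.
  rewrite in_itv/= andbT ltrNl; apply: (le_lt_trans _ (truncnS_gt _)).
  by rewrite -normrN ler_norm.
- by move=> _ [x ->]; exact: G12.
- by move=> n; rewrite (le_lt_trans (probability_le1 _ _)) ?ltry.
- exact: mA.
Qed.

(** The Galois connection between quantile and cdf. Right continuity of the cdf is what makes the
    infimum attained. *)
Lemma quantile_le (nu : probability Rm R) (u x : R) : (0 < u < 1)%R ->
  (quantile nu u <= x)%R = (u <= cdf_of nu x)%R.
Proof.
move=> /andP[u0 u1]; apply/idP/idP => [qx|ux].
- have uy y : (x < y)%R -> (u <= cdf_of nu y)%R.
    move=> xy; have /inf_lt : (quantile nu u < y)%R by exact: le_lt_trans xy.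
    move=> -[].
      have /fine_cvg cv := cvg_cdfy1 (id_RV : {RV nu >-> R}).
      have [z /= /ltW uz] : exists z, (u < cdf_of nu z)%R.
        exact: (filter_ex (cvgr_gt _ cv _ u1)).
      by exists z.
    move=> z /= uz zy; apply: (le_trans uz).
    by apply: nondecreasing_cdf_of; exact: ltW.
  have rc : cdf_of nu y @[y --> x^'+] --> cdf_of nu x.
    apply: fine_cvg; rewrite fineK ?fin_num_measure//.
    exact: cdf_right_continuous.
  apply: (cvgr_to_ge rc).
  by near=> y; apply: uy; near: y; exact: nbhs_right_gt.
- apply: ge_inf => //.
  have /fine_cvg cv := cvg_cdfNy0 (id_RV : {RV nu >-> R}).
  have [y /= yu] : exists y, (cdf_of nu y < u)%R.
    exact: (filter_ex (cvgr_lt _ cv _ u0)).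
  exists y => z /= uz; rewrite leNgt; apply/negP => /ltW zy.
  by have := lt_le_trans yu uz; rewrite ltNge nondecreasing_cdf_of.
Unshelve. all: by end_near. Qed.

End real_probabilities.

(** * The standard Gaussian law and its probability integral transform *)

Section standard_gaussian.
Context {R : realType}.
Local Notation Rm := (measurableTypeR R).
Local Notation leb := (@lebesgue_measure R).

Definition gam : probability Rm R := normal_prob (0 : R) 1.

Lemma gam_countable (C : set R) : countable C -> gam C = 0%E.
Proof.
move=> cC; have mC : measurable (C : set Rm) by exact: countable_measurable.
have /null_content_dominatesP := @normal_prob_dominates R 0 1.
apply => //; exact: countable_lebesgue_measure0.
Qed.

Lemma gam_itv_le (x y : R) :
  (gam `]x, y]%classic <= (normal_peak 1 * Num.max 0 (y - x))%:E)%E.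
Proof.
rewrite /gam/= /normal_prob.
apply: (@le_trans _ _ (\int[leb]_(z in `]x, y]) (normal_peak (1 : R))%:E)%E).
  apply: ge0_le_integral => //=.
  - by move=> z _; rewrite lee_fin normal_pdf_ge0.
  - apply/measurable_EFinP/measurable_funTS; exact: measurable_normal_pdf.
  - by move=> z _; rewrite lee_fin normal_pdf_ub ?oner_neq0.
rewrite integral_cst//= EFinM lee_wpmul2l//=; first by rewrite lee_fin normal_peak_ge0.
rewrite lebesgue_measure_itv/= lte_fin.
case: ifPn => [xy|xy]; last by rewrite lee_fin le_max lexx.
by rewrite -EFinB lee_fin le_max lexx orbT.
Qed.

Lemma gam_itv_gt0 (x y : R) : x < y -> (0 < gam `]x, y]%classic)%E.
Proof.
(* On ]x, y] one has [|z| <= |x| + |y|], so m, the density at [|x| + |y|], is a positive lower bound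
   there. *)
move=> xy; pose m := normal_peak 1 * expR (- (`|x| + `|y|) ^+ 2 / (1 ^+ 2 *+ 2)) : R.
have m0 : 0 < m by rewrite mulr_gt0 ?expR_gt0 ?normal_peak_gt0 ?oner_neq0.
apply: (@lt_le_trans _ _ (\int[leb]_(z in `]x, y]) m%:E)%E).
  rewrite integral_cst//= lebesgue_measure_itv/= lte_fin xy -EFinB -EFinM lte_fin.
  by rewrite mulr_gt0// subr_gt0.
rewrite /gam/= /normal_prob; apply: ge0_le_integral => //=.
- by move=> z _; rewrite lee_fin ltW.
- apply/measurable_EFinP/measurable_funTS; exact: measurable_normal_pdf.
- move=> z; rewrite in_itv/= => /andP[xz zy].
  rewrite lee_fin normal_pdfE ?oner_neq0// /m ler_wpM2l ?normal_peak_ge0//.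
  rewrite /normal_fun ler_expR ler_wpM2r ?invr_ge0// ?mulrn_wge0 ?exprn_ge0//.
  rewrite lerN2 subr0 -(@real_normK _ z) ?num_real// lerXn2r ?nnegrE ?addr_ge0//.
  rewrite ler_norml; apply/andP; split.
    rewrite lerNl; apply: le_trans (ltW (_ : - z < - x)) _; first by rewrite ltrN2.
    by rewrite (le_trans (ler_norm _))// normrN lerDl.
  by rewrite (le_trans zy)// (le_trans (ler_norm _))// lerDr.
Qed.

Let Phi : R -> R := cdf_of gam.

Lemma gam_itvE (x y : R) : x <= y -> (gam `]x, y]%classic = (Phi y - Phi x)%:E)%E.
Proof.
move=> xy; rewrite EFinB !cdf_ofE.
have -> : `]x, y]%classic = `]-oo, y] `\` `]-oo, x] :> set R.
  by rewrite -[RHS]setCK setCD setCitvl setUC -[LHS]setCK setCitv.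
rewrite measureD//=.
  by rewrite setIidr//; apply: subset_itvl; rewrite bnd_simp.
by rewrite -ge0_fin_numE// fin_num_measure.
Qed.

Lemma Phi_lt (x y : R) : x < y -> Phi x < Phi y.
Proof.
move=> xy; have := gam_itv_gt0 xy.
by rewrite gam_itvE ?ltW// lte_fin subr_gt0.
Qed.

Lemma Phi_in01 (x : R) : 0 < Phi x < 1.
Proof.
apply/andP; split.
  apply: le_lt_trans (Phi_lt (_ : x - 1 < x)); first exact: cdf_of_ge0.
  by rewrite ltrBlDr ltrDl.
apply: lt_le_trans (Phi_lt (_ : x < x + 1)) _; last exact: cdf_of_le1.
by rewrite ltrDl.
Qed.

(** [Phi] pushes [gam] to the uniform law. The bounded density makes [Phi] continuous, so an
    interior level v is attained at its quantile; the positive density makes [Phi] strictly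
    increasing, so the sublevel set is a ray. *)
Lemma gam_Phi_le (v : R) : 0 <= v <= 1 -> (gam [set x | (Phi x <= v)%R] = v%:E)%E.
Proof.
move=> /andP[]; rewrite le_eqVlt => /predU1P[<- _|v0].
  have -> : [set x | (Phi x <= 0)%R] = set0; last by rewrite measure0.
  rewrite -subset0 => x /=; have /andP[+ _] := Phi_in01 x.
  by rewrite ltNge => /negP.
rewrite le_eqVlt => /predU1P[->|v1].
  have -> : [set x | (Phi x <= 1)%R] = setT; last exact: probability_setT.
  by rewrite -subTset => x _ /=; have /andP[_ /ltW] := Phi_in01 x.
have v01 : 0 < v < 1 by rewrite v0.
pose x0 := quantile gam v.
have vx0 : v <= Phi x0 by rewrite -quantile_le.
have Phix0 : Phi x0 = v.
  apply/eqP; rewrite eq_le vx0 andbT; apply/ler_addgt0Pr => e e0.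
  have peak0 : 0 < normal_peak 1 :> R by rewrite normal_peak_gt0 ?oner_neq0.
  (* With this gap the density bound gives ]y, x0] mass at most e, while [y < x0] keeps [Phi y]
     below v. *)
  pose y := x0 - e / normal_peak 1.
  have yx0 : y < x0 by rewrite ltrBlDr ltrDl divr_gt0.
  have yv : Phi y < v.
    by rewrite ltNge -quantile_le// -ltNge.
  have := gam_itv_le y x0; rewrite (gam_itvE (ltW yx0)) lee_fin lerBlDr.
  move=> /le_trans; apply.
  rewrite addrC lerD//; first exact: ltW.
  rewrite /y opprB addrCA subrr addr0 max_r; last by rewrite divr_ge0 ?ltW.
  by rewrite mulrC divfK// gt_eqF.
have -> : [set x | (Phi x <= v)%R] = `]-oo, x0]%classic.
  apply/seteqP; split => x /=; rewrite in_itv/= -Phix0.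
    by apply: contraTT; rewrite -!ltNge; exact: Phi_lt.
  exact: nondecreasing_cdf_of.
by rewrite -Phix0 cdf_ofE.
Qed.

End standard_gaussian.

Section bass_map.
Context {R : realType} (mu : probability (measurableTypeR R) R).
Local Notation Rm := (measurableTypeR R).

Lemma nondecreasing_bass_map : nondecreasing_fun (bass_map mu : R -> R).
Proof.
move=> x y xy; have /andP[x0 _] := Phi_in01 x; have /andP[_ y1] := Phi_in01 y.
by apply: nondecreasing_quantile => //; exact: nondecreasing_cdf_of.
Qed.

(** By the Galois connection, h y <= x exactly when [Phi y] is at most the cdf of mu at x, an event
    whose mass is that cdf. *)
Lemma bass_map_distribution (A : set Rm) : measurable A ->
  gam (bass_map mu @^-1` A) = mu A.
Proof.
move=> mA; rewrite -[LHS]/(distribution gam (bass_map mu) A).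
apply: probability_unique_ray => // x.
rewrite -(cdf_ofE mu) -gam_Phi_le ?cdf_of_ge0 ?cdf_of_le1//.
rewrite /distribution/= /pushforward; congr (gam _).
by apply/seteqP; split => y /=; rewrite in_itv/= /bass_map quantile_le ?Phi_in01.
Qed.

End bass_map.

(** * Measurability with respect to a filtration, and independence *)

Section sub_sigma_algebra.
Context d (T : measurableType d) (G : set (set T)).
Hypothesis sG : sigma_algebra [set: T] G.

(** A filtration is a bare family of sets of sets. Reading adaptedness as measurability over the
    generated type makes the rules for compositions, pairs and generators available at each
    [F t]. *)
Lemma measurable_sub_sigmaP d' (E : measurableType d') (X : T -> E) :
  measurable_fun [set: g_sigma_algebraType G] X <->
  (forall U, measurable U -> G (X @^-1` U)).
Proof.
have mE : @measurable _ (g_sigma_algebraType G) = G.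
  rewrite /measurable/=; exact: sigma_algebra_id.
split=> [mX U mU|GX _ U mU]; last by rewrite setTI mE; exact: GX.
by rewrite -mE -[_ @^-1` _]setTI; exact: mX.
Qed.

End sub_sigma_algebra.

Lemma integral_cst_probability d (T : measurableType d) (R : realType)
  (P : probability T R) (c : \bar R) : (\int[P]_x c = c)%E.
Proof.
by rewrite -[LHS]/(\int[P]_x cst c x)%E integral_cst//= probability_setT mule1.
Qed.

Section independence.
Local Open Scope ereal_scope.
Context d (T : measurableType d) (R : realType) (P : probability T R).

(** Freezing: the factorisation on rectangles identifies the joint law with a product measure, and
    Tonelli integrates Y out with X held fixed. *)
Lemma integral_independent d1 d2 (E1 : measurableType d1)
    (E2 : measurableType d2) (X : T -> E1) (Y : T -> E2)
    (G : E1 * E2 -> \bar R) (mY : probability E2 R) :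
  measurable_fun [set: T] X -> measurable_fun [set: T] Y ->
  measurable_fun [set: E1 * E2] G -> (forall z, 0 <= G z) ->
  (forall U V, measurable U -> measurable V ->
    P (X @^-1` U `&` Y @^-1` V) = P (X @^-1` U) * mY V) ->
  \int[P]_o G (X o, Y o) = \int[P]_o \int[mY]_y G (X o, y).
Proof.
move=> mX mYf mG G0 XY.
pose X' : {mfun T >-> E1} := HB.pack X (isMeasurableFun.Build _ _ _ _ X mX).
have mXY : measurable_fun [set: T] (fun o => (X o, Y o)).
  exact: measurable_fun_pair.
pose XY' : {mfun T >-> (E1 * E2)%type} :=
  HB.pack (fun o => (X o, Y o)) (isMeasurableFun.Build _ _ _ _ _ mXY).
transitivity (\int[distribution P XY']_z G z).
  by rewrite ge0_integral_distribution.
transitivity (\int[(distribution P X' \x mY)%E]_z G z).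
  apply: eq_measure_integral => W mW _; apply/esym.
  by apply: product_measure_unique => // U V mU mV; exact: XY.
rewrite fubini_tonelli1// ge0_integral_distribution//.
- exact: measurable_fun_fubini_tonelli_F.
- by move=> x; apply: integral_ge0.
Qed.

End independence.

Section gaussian_kernel.
Context {R : realType}.
Local Notation Rm := (measurableTypeR R).
Local Notation gam := (@gam R).

Definition sdev (t : R) : R := Num.sqrt (1 - t).

Lemma measurable_sdev : measurable_fun [set: Rm] (sdev : Rm -> Rm).
Proof.
apply: continuous_measurable_fun => x; apply: continuous_comp.
  by apply: cvgB; [exact: cvg_cst|exact: cvg_id].
exact: sqrt_continuous.
Qed.

Lemma aff0 (b : R) : aff b 0 = cst b.
Proof. by apply/funext => z; rewrite /aff mul0r addr0. Qed.

Lemma aff01 : aff (0 : R) 1 = id.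
Proof. by apply/funext => z; rewrite /aff mul1r add0r. Qed.

(* [gint g t b] is the integral of g against N(b, 1 - t), so that
   [gint g t (B t)] is a version of E[g(B_1) | F_t]. *)
Definition gint (g : R -> \bar R) (t b : R) : \bar R :=
  (\int[gam]_z g (aff b (sdev t) z))%E.

Lemma gint_ge0 g t b : (forall x, 0 <= g x)%E -> (0 <= gint g t b)%E.
Proof. by move=> g0; apply: integral_ge0. Qed.

Lemma measurable_aff3 :
  measurable_fun [set: (Rm * Rm * Rm)%type] (fun z => aff z.1.2 (sdev z.1.1) z.2 : Rm).
Proof.
apply: measurable_funD.
  exact: (measurableT_comp measurable_snd measurable_fst).
apply: measurable_funM => //.
apply: (measurableT_comp measurable_sdev).
exact: (measurableT_comp measurable_fst measurable_fst).
Qed.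

Lemma measurable_gint2 g : measurable_fun [set: Rm] g -> (forall x, 0 <= g x)%E ->
  measurable_fun [set: (Rm * Rm)%type] (fun z => gint g z.1 z.2).
Proof.
move=> mg g0.
apply: (@measurable_fun_fubini_tonelli_F _ _ _ Rm R gam
  (fun z : (Rm * Rm) * Rm => g (aff z.1.2 (sdev z.1.1) z.2))) => //.
exact: (measurableT_comp mg measurable_aff3).
Qed.

Lemma measurable_gint g t : measurable_fun [set: Rm] g -> (forall x, 0 <= g x)%E ->
  measurable_fun [set: Rm] (gint g t).
Proof.
move=> mg g0; have m2 := measurable_gint2 mg g0.
apply: (measurableT_comp m2 (_ : measurable_fun _ (fun b : Rm => (t : Rm, b)))).
exact: measurable_fun_pair.
Qed.

Lemma normal_pdf_le_gam (b s : R) : 0 < s < 1 ->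
  exists2 C : R, 0 <= C & forall x, normal_pdf b s x <= C * normal_pdf 0 1 x.
Proof.
move=> /andP[s0 s1].
have s0' : s != 0 by rewrite gt_eqF.
have s21 : 0 < 1 - s ^+ 2 by rewrite subr_gt0 expr_lt1// ltW.
(* The exponent gap x^2 / 2 - (x - b)^2 / (2 s^2) is largest at x = b / (1 - s^2), where it equals
   b^2 / (2 (1 - s^2)). Completing the square turns the remaining gap into the quotient displayed
   below. *)
exists (normal_peak s / normal_peak 1 * expR (b ^+ 2 / (1 - s ^+ 2) / 2)).
  by rewrite mulr_ge0 ?expR_ge0// divr_ge0// normal_peak_ge0.
move=> x; rewrite !normal_pdfE ?oner_neq0//.
rewrite [leRHS](_ : _ = normal_peak s * (expR (b ^+ 2 / (1 - s ^+ 2) / 2) *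
    normal_fun 0 1 x)); last first.
  by field; rewrite gt_eqF// normal_peak_gt0 ?oner_neq0.
rewrite ler_wpM2l ?normal_peak_ge0// /normal_fun -expRD ler_expR -subr_ge0.
rewrite [leRHS](_ : _ = ((1 - s ^+ 2) * x - b) ^+ 2 / (2 * s ^+ 2 * (1 - s ^+ 2))).
  by rewrite divr_ge0 ?sqr_ge0// !mulr_ge0 ?sqr_ge0// ltW.
by field; rewrite s0'/= gt_eqF.
Qed.

(** Intended for the moments of the Bass MVM, which its definition requires at every sample point;
    conditional expectations would give them only almost surely. *)
Lemma normal_prob_le_gam (b s : R) (g : R -> \bar R) : 0 < s < 1 ->
  measurable_fun [set: Rm] g -> (forall x, 0 <= g x)%E ->
  (\int[gam]_x g x < +oo -> \int[gam]_z g (aff b s z) < +oo)%E.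
Proof.
move=> s01 mg g0 goo; have [C C0 hC] := normal_pdf_le_gam b s01.
have /andP[s0 _] := s01.
have -> : (\int[gam]_z g (aff b s z) = \int[normal_prob b s]_x g x)%E.
  transitivity (\int[distribution gam (aff b s)]_x g x)%E.
    by rewrite ge0_integral_distribution.
  by apply: eq_measure_integral => A mA _; exact/esym/normal_prob_aff.
pose C' : {nonneg R} := NngNum C0.
apply: (@le_lt_trans _ _ (\int[mscale C' gam]_x g x)%E).
  apply: ge0_le_measure_integral => // A mA.
  rewrite /= /mscale/= /normal_prob -ge0_integralZl//; last 2 first.
  - by apply/measurable_EFinP/measurable_funTS; exact: measurable_normal_pdf.
  - by move=> x _; rewrite lee_fin normal_pdf_ge0.
  apply: ge0_le_integral => //.
  - by move=> x _; rewrite lee_fin normal_pdf_ge0.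
  - by apply/measurable_EFinP/measurable_funTS; exact: measurable_normal_pdf.
  - apply: measurable_funeM.
    by apply/measurable_EFinP/measurable_funTS; exact: measurable_normal_pdf.
  - by move=> x _; rewrite -EFinM lee_fin.
rewrite ge0_integral_mscale//.
by rewrite lte_mul_pinfty.
Qed.

End gaussian_kernel.

(** * The Bass martingale *)

Lemma measurable_abs_powR (R : realType) (p : R) :
  measurable_fun [set: measurableTypeR R] (fun x : measurableTypeR R => (`|x| `^ p)%:E).
Proof.
apply/measurable_EFinP; apply: (measurableT_comp (measurable_powR p)).
exact: normr_measurable.
Qed.

Section brownian.
Context (R : realType) (d : measure_display) (T : measurableType d).
Variables (P : probability T R) (F : R -> set (set T)) (B : R -> T -> R).
Local Notation Rm := (measurableTypeR R).
Local Notation gam := (@gam R).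
Hypothesis filtF : filtration F.
Hypothesis bmB : brownian_motion P F B.

Lemma filtration_measurable t A : 0 <= t <= 1 -> F t A -> measurable A.
Proof. by move=> t01; have [/(_ t t01)[_ sF] _] := filtF; exact: sF. Qed.

Lemma brownian_measurable_sub t : 0 <= t <= 1 ->
  measurable_fun [set: g_sigma_algebraType (F t)] (B t : T -> Rm).
Proof.
move=> t01; have [/(_ t t01)[sF _] _] := filtF.
by apply/(measurable_sub_sigmaP sF) => U mU; have [adB _ _ _ _] := bmB; exact: adB.
Qed.

Lemma brownian_measurable t : 0 <= t <= 1 ->
  measurable_fun [set: T] (B t : T -> Rm).
Proof.
move=> t01 _ U mU; rewrite setTI; apply: (filtration_measurable t01).
by have [adB _ _ _ _] := bmB; exact: adB.
Qed.

Lemma eta_gam t o (A : set Rm) : 0 <= t <= 1 -> measurable A ->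
  eta B t o A = gam (aff (B t o) (sdev t) @^-1` A).
Proof.
move=> /andP[t0]; rewrite le_eqVlt => /predU1P[->|t1] mA; rewrite /eta.
  rewrite ltxx /sdev subrr sqrtr0 aff0 preimage_cst/= diracE.
  by case: ifPn => _; rewrite ?probability_setT ?measure0.
by rewrite t1; apply: normal_prob_aff; rewrite ?sqrtr_gt0 ?subr_gt0.
Qed.

Lemma integral_eta t o (g : R -> \bar R) : 0 <= t <= 1 ->
  measurable_fun [set: Rm] g -> (forall x, 0 <= g x)%E ->
  (\int[eta B t o]_x g x = gint g t (B t o))%E.
Proof.
move=> t01 mg g0.
transitivity (\int[distribution gam (aff (B t o) (sdev t))]_x g x)%E.
  by apply: eq_measure_integral => A mA _; exact: eta_gam.
by rewrite ge0_integral_distribution.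
Qed.

Lemma integral_bass mu t o (g : R -> \bar R) : 0 <= t <= 1 ->
  measurable_fun [set: Rm] g -> (forall x, 0 <= g x)%E ->
  (\int[bass_mvm mu B t o]_x g x = gint (g \o bass_map mu) t (B t o))%E.
Proof.
move=> t01 mg g0; rewrite /bass_mvm ge0_integral_distribution//.
apply: integral_eta => //; last by move=> x; exact: g0.
apply: (measurableT_comp mg); exact: measurable_bass_map.
Qed.

(** [B 1] is [B s] plus a Gaussian increment independent of [F s]; freezing [B s] leaves the
    Gaussian integral [gint g s]. *)
Lemma markov_gaussian s A (g : R -> \bar R) : 0 <= s <= 1 -> F s A ->
  measurable_fun [set: Rm] g -> (forall x, 0 <= g x)%E ->
  (\int[P]_(o in A) g (B 1 o) = \int[P]_(o in A) gint g s (B s o))%E.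
Proof.
move=> s01 FA mg g0; have /andP[s0] := s01.
(* The law of an increment is prescribed for distinct times only; at s = 1 the kernel reduces to
   evaluation at [B 1]. *)
rewrite le_eqVlt => /predU1P[s1|s1].
  apply: eq_integral => o _; rewrite /gint s1 /sdev subrr sqrtr0 aff0.
  by rewrite -[LHS](integral_cst_probability gam).
have mA := filtration_measurable s01 FA.
have [sF _] := filtF.1 s s01.
have [adB _ _ lawB indB] := bmB.
(* Carrying the event A as a boolean coordinate makes X a single [F s]-measurable variable, and
   turns the integral over A into one over the whole space. *)
pose X o : bool * Rm := (o \in A, B s o).
have sA : measurable_fun [set: g_sigma_algebraType (F s)] (fun o => o \in A).
  apply: (measurable_fun_bool true); rewrite setTI.
  rewrite (_ : _ @^-1` _ = A); first by apply: sub_sigma_algebra.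
  by apply/seteqP; split => o /=; [exact: set_mem|exact: mem_set].
have sX : measurable_fun [set: g_sigma_algebraType (F s)] X.
  by apply: measurable_fun_pair => //; exact: brownian_measurable_sub.
have mX : measurable_fun [set: T] X.
  move=> _ U mU; rewrite setTI; apply: (filtration_measurable s01).
  exact: (measurable_sub_sigmaP sF X).1.
have mD : measurable_fun [set: T] (increment B s 1).
  apply: measurable_funB; apply: brownian_measurable => //.
  by rewrite ler01 lexx.
pose mY := normal_prob (0 : R) (Num.sqrt (1 - s)) : probability Rm R.
pose G (z : (bool * Rm) * Rm) : \bar R := if z.1.1 then g (z.1.2 + z.2) else 0%E.
have G0 z : (0 <= G z)%E by rewrite /G; case: ifP.
have mG : measurable_fun [set: (bool * Rm) * Rm] G.
  apply: measurable_fun_ifT => //.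
    exact: (measurableT_comp measurable_fst measurable_fst).
  apply: (measurableT_comp mg).
  apply: measurable_funD => //.
  exact: (measurableT_comp measurable_snd measurable_fst).
have XD (U : set (bool * Rm)) (V : set Rm) : measurable U -> measurable V ->
    (P (X @^-1` U `&` increment B s 1 @^-1` V) = P (X @^-1` U) * mY V)%E.
  move=> mU mV; rewrite indB// ?lawB//.
  exact: (measurable_sub_sigmaP sF X).1.
have GE := integral_independent mX mD mG G0 XD.
rewrite [LHS]integral_mkcond [RHS]integral_mkcond.
transitivity (\int[P]_o G (X o, increment B s 1 o))%E.
  apply: eq_integral => o _; rewrite patchE /G/=; case: ifPn => // _.
  by rewrite /increment addrC subrK.
rewrite GE; apply: eq_integral => o _; rewrite patchE /G/=; case: ifPn => _; last first.
  by rewrite integral0.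
transitivity (\int[distribution gam (aff 0 (sdev s))]_y g (B s o + y)%R)%E.
  apply: eq_measure_integral => V mV _; apply: normal_prob_aff => //.
  by rewrite sqrtr_gt0 subr_gt0.
rewrite ge0_integral_distribution//; last first.
  by apply: (measurableT_comp mg); exact: measurable_funD.
by apply: eq_integral => z _; rewrite /= /aff add0r.
Qed.

End brownian.

Section bass_mvm_is_mvm.
Context (R : realType) (d : measure_display) (T : measurableType d).
Variables (P : probability T R) (F : R -> set (set T)) (B : R -> T -> R).
Local Notation Rm := (measurableTypeR R).
Local Notation gam := (@gam R).
Hypothesis filtF : filtration F.
Hypothesis bmB : brownian_motion P F B.
Variable mu : probability Rm R.
Local Notation h := (bass_map mu).
Local Notation xi := (bass_mvm mu B).

Lemma bass_mvm_gint t o (A : set Rm) : 0 <= t <= 1 -> measurable A ->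
  xi t o A = gint (fun x => (\1_A (h x))%:E) t (B t o).
Proof.
move=> t01 mA; transitivity (\int[xi t o]_x (\1_A x)%:E)%E.
  by rewrite integral_indic// setIT.
rewrite (@integral_bass _ _ _ B mu t o (fun x => (\1_A x)%:E))//.
by apply/measurable_EFinP; exact: measurable_indic.
Qed.

Lemma adapted_bass_mvm : adapted F (xi : R -> T -> pprobability Rm R).
Proof.
move=> t t01; have [sF _] := filtF.1 t t01.
apply/(measurable_sub_sigmaP sF).
apply: (measurability (@pset _ _ _ : set (set (pprobability Rm R)))) => //.
move=> _ -[_ [r r01] [A mA <-]] <-; rewrite setTI.
pose g b := gint (fun x => (\1_A (h x))%:E) t b.
have mgR : measurable_fun [set: Rm] g.
  apply: measurable_gint.
    apply/measurable_EFinP; apply: measurableT_comp.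
      exact: measurable_indic.
    exact: measurable_bass_map.
  by move=> x; rewrite lee_fin.
have mg := measurableT_comp mgR (brownian_measurable_sub filtF bmB t01).
rewrite (_ : _ @^-1` _ = (g \o B t) @^-1` `]-oo, r%:E[%classic).
  rewrite -[X in measurable X]setTI; apply: mg => //.
  exact: emeasurable_itv.
by apply/seteqP; split => o /=; rewrite in_itv/= /mset/= bass_mvm_gint.
Qed.

Lemma finite_moment_bass (p : R) t o : finite_moment p mu -> 0 <= t <= 1 ->
  finite_moment p (xi t o).
Proof.
move=> pmu t01; rewrite /finite_moment.
have mp : measurable_fun [set: Rm] (fun x : Rm => (`|x| `^ p)%:E).
  exact: measurable_abs_powR.
have p0 (x : R) : (0 <= (`|x| `^ p)%:E)%E by rewrite lee_fin powR_ge0.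
rewrite (@integral_bass _ _ _ B mu t o (fun x => (`|x| `^ p)%:E))//.
have mph : measurable_fun [set: Rm] (fun x : Rm => (`|h x| `^ p)%:E).
  exact: (measurableT_comp mp (measurable_bass_map mu)).
have gmu : (\int[gam]_x (`|h x| `^ p)%:E < +oo)%E.
  apply: le_lt_trans pmu.
  have -> : (\int[mu]_x (`|x| `^ p)%:E =
             \int[distribution gam h]_x (`|x| `^ p)%:E)%E.
    apply: eq_measure_integral => A mA _.
    exact/esym/bass_map_distribution.
  by rewrite ge0_integral_distribution.
(* Domination by [gam] needs a standard deviation strictly between 0 and 1. At time 1 the law is a
   Dirac mass, at time 0 it is the law of h under [gam]. *)
move/andP : t01 => [t0]; rewrite le_eqVlt => /predU1P[->|t1].
  rewrite /gint /sdev subrr sqrtr0 aff0.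
  under eq_integral do rewrite /=.
  by rewrite integral_cst_probability ltry.
move: t0; rewrite le_eqVlt => /predU1P[<-|t0].
  have [_ B0 _ _ _] := bmB.
  by rewrite /gint B0 /sdev subr0 sqrtr1 aff01.
apply: (@normal_prob_le_gam _ (B t o) (sdev t) (fun x => (`|h x| `^ p)%:E)) => //.
  rewrite sqrtr_gt0 subr_gt0 t1/= -[ltRHS]sqrtr1 ltr_sqrt//.
  by rewrite ltrBlDr ltrDl.
Qed.

Lemma martingale_bass (f : R -> R) (K : R) : continuous f ->
  (forall x, `|f x| <= K) ->
  martingale P F (fun t o => \int[xi t o]_(x in [set: Rm]) f x).
Proof.
move=> cf fK.
have mf : measurable_fun [set: Rm] (f : Rm -> Rm) by exact: continuous_measurable_fun.
have K0 : 0 <= K by exact: le_trans (fK 0).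
(* The shift by K makes the integrand nonnegative, as [gint] and the Markov property require; the
   constant is subtracted again in [ME]. *)
pose g (x : R) : \bar R := (f (h x) + K)%:E.
have g0 x : (0 <= g x)%E.
  by rewrite lee_fin -lerBlDr sub0r; have := fK (h x); rewrite ler_norml => /andP[].
have g2 x : (g x <= (K + K)%:E)%E.
  by rewrite lee_fin lerD2r; have := fK (h x); rewrite ler_norml => /andP[].
have mg : measurable_fun [set: Rm] g.
  apply/measurable_EFinP; apply: measurable_funD => //.
  exact: measurableT_comp mf (measurable_bass_map mu).
pose v t b := fine (gint g t b).
have gint_le t b : (gint g t b <= (K + K)%:E)%E.
  rewrite -(integral_cst_probability gam (K + K)%:E).
  apply: ge0_le_integral => //.
  by apply: (measurableT_comp mg); exact: measurable_aff.
have gint0 t b : (0 <= gint g t b)%E by exact: gint_ge0.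
have gintE t b : (v t b)%:E = gint g t b.
  rewrite /v fineK// ge0_fin_numE//; apply: le_lt_trans (gint_le t b) _.
  by rewrite ltry.
have v0 t b : 0 <= v t b by rewrite fine_ge0.
have v2 t b : v t b <= K + K by rewrite -lee_fin gintE.
have ME t o : 0 <= t <= 1 ->
    \int[xi t o]_(x in [set: Rm]) f x = v t (B t o) - K.
  move=> t01.
  have fi (k : R) : (xi t o).-integrable setT (EFin \o (cst k : R -> R)).
    exact: finite_measure_integrable_cst.
  have ff : (xi t o).-integrable setT (EFin \o f).
    apply: measurable_bounded_integrable => //.
      by rewrite (le_lt_trans (probability_le1 _ _))// ltry.
    by exists K; split; [exact: num_real|move=> z Kz x _ /=; rewrite (le_trans (fK x)) ?ltW].
  apply/eqP; rewrite -subr_eq opprK; apply/eqP.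
  rewrite /v -(@integral_bass _ _ _ B mu t o (fun x => (f x + K)%:E))//; last 2 first.
  - by apply/measurable_EFinP; exact: measurable_funD.
  - by move=> x; rewrite lee_fin -lerBlDr sub0r; have := fK x; rewrite ler_norml => /andP[].
  rewrite -[RHS]/(\int[xi t o]_(x in [set: Rm]) (f x + (cst K) x)) RintegralD//.
  congr (_ + _); rewrite [RHS]/Rintegral.
  by rewrite -[RHS]/(fine (\int[xi t o]_x K%:E)%E) integral_cst_probability.
have mM t : measurable_fun [set: Rm] (v t : Rm -> Rm).
  apply: measurableT_comp => //; exact: measurable_gint.
have mvB t : 0 <= t <= 1 -> measurable_fun [set: T] (v t \o B t : T -> Rm).
  move=> t01; exact: (measurableT_comp (mM t) (brownian_measurable filtF bmB t01)).
have iv t A : 0 <= t <= 1 -> measurable A -> P.-integrable A (EFin \o (v t \o B t)).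
  move=> t01 mA; apply: measurable_bounded_integrable => //.
  - by rewrite (le_lt_trans (probability_le1 _ _))// ltry.
  - by apply: measurable_funTS; exact: mvB.
  - exists (K + K); split; [exact: num_real|move=> z Kz x _ /=].
    by rewrite ger0_norm// (le_trans (v2 _ _))// ltW.
have ic A : measurable A -> P.-integrable A (EFin \o cst K).
  by move=> mA; exact: finite_measure_integrable_cst.
have EM t A : 0 <= t <= 1 -> measurable A ->
  (\int[P]_(o in A) (\int[xi t o]_(x in [set: Rm]) f x)%:E =
   \int[P]_(o in A) gint g t (B t o) - \int[P]_(o in A) K%:E)%E.
  move=> t01 mA.
  transitivity (\int[P]_(o in A) ((v t (B t o))%:E - K%:E))%E.
    by apply: eq_integral => o _; rewrite ME.
  rewrite integralB_EFin//; [|exact: (iv t)|exact: ic].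
  by congr (_ - _)%E; apply: eq_integral => o _; rewrite gintE.
split.
- move=> t t01; have [sF _] := filtF.1 t t01.
  apply/(measurable_sub_sigmaP sF).
  rewrite (_ : (fun o => _) = (fun o => v t (B t o) - K)); last first.
    by apply/funext => o; rewrite ME.
  apply: measurable_funB => //.
  exact: (measurableT_comp (mM t) (brownian_measurable_sub filtF bmB t01)).
- move=> t t01.
  apply: (eq_integrable _ (EFin \o (fun o => v t (B t o) - K))) => //.
    by move=> o _ /=; rewrite ME.
  rewrite [X in _.-integrable _ X](_ : _ =
    (EFin \o (v t \o B t)) \- (EFin \o cst K))%E; last by [].
  apply: integrableB => //; [exact: iv|exact: ic].
- move=> s t s0 st t1 A FA.
  have s01 : 0 <= s <= 1 by rewrite s0 (le_trans st).
  have t01 : 0 <= t <= 1 by rewrite t1 (le_trans s0).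
  have mA := filtration_measurable filtF s01 FA.
  have FtA : F t A by exact: filtF.2 FA.
  have Mst : (\int[P]_(o in A) gint g t (B t o) = \int[P]_(o in A) gint g s (B s o))%E.
    exact: etrans (esym (markov_gaussian filtF bmB t01 FtA mg g0))
      (markov_gaussian filtF bmB s01 FA mg g0).
  refine (etrans (EM t A t01 mA) (etrans _ (esym (EM s A s01 mA)))).
  exact (f_equal (fun z => z - \int[P]_(o in A) K%:E)%E Mst).
Qed.

Lemma finite_moment1 (p : R) (nu : probability Rm R) : 1 <= p ->
  finite_moment p nu -> finite_moment 1 nu.
Proof.
move=> p1 pnu; rewrite /finite_moment.
have mp q : measurable_fun [set: Rm] (fun x : Rm => (`|x| `^ q)%:E).
  exact: measurable_abs_powR.
apply: (@le_lt_trans _ _ (\int[nu]_x (1 + (`|x| `^ p)%:E))%E).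
  apply: ge0_le_integral => //.
  - by apply: emeasurable_funD => //; exact: mp.
  - move=> x _; rewrite -EFinD lee_fin powRr1//.
    have [x1|x1] := leP `|x| 1.
      by rewrite (le_trans x1)// lerDl powR_ge0.
    apply: (@le_trans _ _ (`|x| `^ p)); last by rewrite lerDr.
    by rewrite -[leLHS]powRr1// ler_powR// ltW.
rewrite ge0_integralD//.
by rewrite integral_cst_probability lte_add_pinfty ?ltry.
Qed.

Lemma measure_valued_martingale_bass p : 1 <= p -> finite_moment p mu ->
  measure_valued_martingale P F xi.
Proof.
move=> p1 pmu; split; first exact: adapted_bass_mvm.
  by move=> t o t01; apply: finite_moment_bass => //; exact: finite_moment1 pmu.
by move=> f cf [K fK]; exact: martingale_bass fK.
Qed.

Lemma bass_mvm_0 o (A : set Rm) : measurable A -> xi 0 o A = mu A.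
Proof.
move=> mA; have [_ B0 _ _ _] := bmB.
have mhA : measurable (h @^-1` A : set Rm).
  by rewrite -[X in measurable X]setTI; exact: measurable_bass_map.
have t01 : 0 <= (0 : R) <= 1 by rewrite lexx/=.
rewrite -[LHS]/(eta B 0 o (h @^-1` A)); apply: etrans (eta_gam B o t01 mhA) _.
by rewrite B0 /sdev subr0 sqrtr1 aff01; exact: bass_map_distribution.
Qed.

End bass_mvm_is_mvm.

(** * Path regularity of the Bass martingale *)

Section doob.
Context (R : realType) (d : measure_display) (T : measurableType d).
Variables (P : probability T R) (F : R -> set (set T)) (B : R -> T -> R).
Local Notation Rm := (measurableTypeR R).
Local Notation gam := (@gam R).
Hypothesis filtF : filtration F.
Hypothesis bmB : brownian_motion P F B.
Variables (g : R -> \bar R) (c : R).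
Hypothesis mg : measurable_fun [set: Rm] g.
Hypothesis g0 : forall x, (0 <= g x)%E.
Hypothesis c0 : 0 < c.

Definition exceed t : set T := [set o | (c%:E < gint g t (B t o))%E].

Lemma exceed_filtration t : 0 <= t <= 1 -> F t (exceed t).
Proof.
move=> t01; have [sF _] := filtF.1 t t01.
rewrite (_ : exceed t = (gint g t \o B t) @^-1` `]c%:E, +oo[%classic).
  apply: (measurable_sub_sigmaP sF (gint g t \o B t)).1; last exact: emeasurable_itv.
  exact: (measurableT_comp (measurable_gint t mg g0)
    (brownian_measurable_sub filtF bmB t01)).
by apply/seteqP; split => o /=; rewrite in_itv/= andbT.
Qed.

Lemma exceed_measurable t : 0 <= t <= 1 -> measurable (exceed t).
Proof.
by move=> t01; apply: (filtration_measurable filtF t01); exact: exceed_filtration.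
Qed.

(* Splitting the event according to the first exceedance time, on each piece
   [gint g] is the conditional expectation of [g (B 1)]. *)
Lemma doob_maximal (tau : nat -> R) : (forall i, 0 <= tau i <= 1) ->
  {homo tau : i j / (i <= j)%N >-> i <= j} ->
  (c%:E * P (\bigcup_i exceed (tau i)) <= \int[gam]_x g x)%E.
Proof.
move=> tau01 ndtau.
pose E i := exceed (tau i).
have FE i : F (tau i) (seqDU E i).
  have [sF _] := filtF.1 _ (tau01 i).
  have mE : @measurable _ (g_sigma_algebraType (F (tau i))) = F (tau i).
    exact: sigma_algebra_id.
  rewrite -mE /seqDU; apply: measurableD.
    by rewrite mE; exact: exceed_filtration.
  apply: bigsetU_measurable => k _; rewrite mE.
  have /andP[_ i1] := tau01 i; have /andP[k0 _] := tau01 k.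
  apply: (filtF.2 (tau k)) => //; last exact: exceed_filtration.
  by apply: ndtau; exact: ltnW.
have mE i : measurable (seqDU E i) by exact: filtration_measurable (FE i).
have tE : trivIset setT (seqDU E) by exact: trivIset_seqDU.
have mgB1 : measurable_fun [set: T] (fun o => g (B 1 o)).
  have t11 : 0 <= (1 : R) <= 1 by rewrite lexx ler01.
  exact: (measurableT_comp mg (brownian_measurable filtF bmB t11)).
rewrite -/(E _) (_ : \bigcup_i _ = \bigcup_i seqDU E i); last exact: seqDU_bigcup_eq.
rewrite -integral_cst; last exact: bigcupT_measurable.
apply: (@le_trans _ _ (\int[P]_(o in \bigcup_i seqDU E i) g (B 1 o))%E).
  have c0' (x : T) : (\bigcup_i seqDU E i) x -> (0 <= cst c%:E x)%E.
    by rewrite lee_fin ltW.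
  rewrite (ge0_integral_bigcup P mE (measurable_cst _) c0' tE).
  rewrite (ge0_integral_bigcup P mE (measurable_funTS mgB1) _ tE)//.
  apply: lee_nneseries => [i _ _|i _]; first by apply: integral_ge0 => x _; rewrite lee_fin ltW.
  apply: (@le_trans _ _ (\int[P]_(o in seqDU E i) gint g (tau i) (B (tau i) o))%E).
    apply: ge0_le_integral => //.
    - by move=> x _; rewrite lee_fin ltW.
    - apply: measurable_funTS.
      exact: (measurableT_comp (measurable_gint (tau i) mg g0)
        (brownian_measurable filtF bmB (tau01 i))).
    - by move=> o [/ltW].
  rewrite le_eqVlt; apply/orP; left; apply/eqP/esym.
  exact: (markov_gaussian filtF bmB (tau01 i) (FE i) mg g0).
have := markov_gaussian filtF bmB (_ : 0 <= (0:R) <= 1) _ mg g0.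
move=> /(_ setT); rewrite lexx ler01 => /(_ isT).
have t01 : 0 <= (0:R) <= 1 by rewrite lexx ler01.
have [sF _] := filtF.1 0 t01; have [_ B0 _ _ _] := bmB.
have FT : F 0 setT.
  by have [F0 FC _] := sF; rewrite -[setT]setD0; exact: FC.
move=> /(_ FT) E1.
apply: (@le_trans _ _ (\int[P]_o g (B 1 o))%E).
  apply: ge0_subset_integral => //; exact: bigcupT_measurable.
rewrite le_eqVlt; apply/orP; left; apply/eqP; refine (etrans E1 _).
rewrite -[RHS](integral_cst_probability P); apply: eq_integral => o _.
by rewrite B0 /gint /sdev subr0 sqrtr1 aff01.
Qed.

(** The cap lets i run over all naturals while the time stays in [0, 1]. *)
Definition dyad (m i : nat) : R := Num.min (i%:R / 2 ^+ m) 1.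

Lemma dyad01 m i : 0 <= dyad m i <= 1.
Proof.
by rewrite /dyad le_min ler01 andbT divr_ge0 ?exprn_ge0//= ge_min lexx orbT.
Qed.

(** Countably many times keep the event measurable; the remaining times are recovered by lower
    semicontinuity along a continuous path. *)
Definition exceed_dyadic : set T := \bigcup_m \bigcup_i exceed (dyad m i).

Lemma exceed_dyadic_measurable : measurable exceed_dyadic.
Proof.
apply: bigcupT_measurable => m; apply: bigcupT_measurable => i.
by apply: exceed_measurable; exact: dyad01.
Qed.

(** The grids are nested, point i of level m being point 2 i of level m + 1, so the bound on each
    grid passes to the union by continuity from below. *)
Lemma doob_dyadic : (c%:E * P exceed_dyadic <= \int[gam]_x g x)%E.
Proof.
pose A m := \bigcup_i exceed (dyad m i).
have mA m : measurable (A m).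
  by apply: bigcupT_measurable => i; apply: exceed_measurable; exact: dyad01.
have ndA : nondecreasing_seq A.
  apply/nondecreasing_seqP => m; apply/subsetPset => o [i _ oi].
  exists (2 * i)%N => //; rewrite (_ : dyad _ _ = dyad m i)//.
  rewrite /dyad exprS natrM; congr (Num.min _ _).
  by field; rewrite expf_neq0// pnatr_eq0.
have cA := nondecreasing_cvg_mu mA exceed_dyadic_measurable ndA.
have cA' : (c%:E * (P \o A) m)%E @[m --> \oo] --> (c%:E * P exceed_dyadic)%E.
  by apply: cvgeZl => //; exact: (cA _ P).
apply: (cvge_to_le cA'); near=> m; apply: doob_maximal; first by move=> i; exact: dyad01.
move=> i j ij; rewrite /dyad le_min !ge_min lexx orbT andbT.
by rewrite ler_pM2r ?invr_gt0 ?exprn_gt0// ler_nat ij.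
Unshelve. all: by end_near. Qed.

End doob.

Section powers.
Context {R : realType}.

Lemma cvg_abs_powR (p x : R) : 0 < p -> `|y| `^ p @[y --> x] --> `|x| `^ p.
Proof.
move=> p0; have [->|x0] := eqVneq x 0.
  rewrite normr0 powR0 ?gt_eqF//; apply/cvgrPdist_lt => e e0.
  have d0 : 0 < e `^ p^-1 by rewrite powR_gt0.
  near=> y; rewrite sub0r normrN ger0_norm ?powR_ge0//.
  have -> : e = (e `^ p^-1) `^ p by rewrite -powRrM mulVf ?gt_eqF// powRr1// ltW.
  have yd : `|y| < e `^ p^-1 by near: y; exists (e `^ p^-1) => //= z /=; rewrite sub0r normrN.
  by apply: gt0_ltr_powR => //; rewrite ?nnegrE ?powR_ge0.
have ax0 : `|x| \in `]0, +oo[ by rewrite in_itv/= normr_gt0 x0.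
have /derivable1_diffP /differentiable_continuous c :=
  @derivable_powR _ 1 p _ ax0.
have cn : `|y| @[y --> x] --> `|x| by apply: cvg_norm; exact: cvg_id.
exact: (cvg_comp _ _ cn c).
Unshelve. all: by end_near. Qed.

Definition clip (n y : R) : R := Num.max (- n) (Num.min n y).

Lemma continuous_clip n : continuous (clip n).
Proof.
move=> x; apply: (@continuous_max _ _ (cst (- n)) (fun y => Num.min n y)).
  exact: cvg_cst.
apply: (@continuous_min _ _ (cst n) id); [exact: cvg_cst|exact: cvg_id].
Qed.

Lemma clip_le n y : 0 <= n -> `|clip n y| <= n.
Proof.
by move=> n0; rewrite ler_norml /clip le_max lexx/= ge_max ge_min lexx/= andbT ge0_cp.
Qed.

Lemma clip_id n y : `|y| <= n -> clip n y = y.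
Proof.
by rewrite ler_norml => /andP[ny yn]; rewrite /clip min_r// max_r.
Qed.

Lemma clip_rem_le n y : 0 <= n -> `|y - clip n y| <= `|y|.
Proof.
move=> n0; have [yn|ny] := leP y n; last first.
  rewrite /clip (min_l (ltW ny)) max_r ?ge0_cp//.
  by rewrite !gtr0_norm ?subr_gt0// ?(le_lt_trans n0)// gerBl.
have [ny|yn'] := leP (- n) y.
  by rewrite /clip min_r// max_r// subrr normr0.
rewrite /clip min_r// (max_l (ltW yn')) opprK.
rewrite !ltr0_norm ?(lt_le_trans yn') ?oppr_le0//; last by rewrite -ltrBrDr sub0r.
by rewrite opprD gerBl.
Qed.

Lemma le_powR3 (p a x y z : R) : 0 < p -> 0 <= a -> 0 <= x -> 0 <= y -> 0 <= z ->
  a <= x + y + z -> a `^ p <= 3 `^ p * (x `^ p + y `^ p + z `^ p).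
Proof.
move=> p0 a0 x0 y0 z0 axyz.
pose m := Num.max x (Num.max y z).
have m0 : 0 <= m by rewrite le_max x0.
apply: (@le_trans _ _ ((3 * m) `^ p)).
  apply: (ge0_ler_powR (ltW p0)); rewrite ?nnegrE ?mulr_ge0//.
  have xm : x <= m by rewrite le_max lexx.
  have ym : y <= m by rewrite !le_max lexx orbT.
  have zm : z <= m by rewrite !le_max lexx !orbT.
  lra.
rewrite powRM// ler_wpM2l ?powR_ge0//.
have hx := powR_ge0 x p; have hy := powR_ge0 y p; have hz := powR_ge0 z p.
have [->|[->|->]] : m = x \/ m = y \/ m = z.
- rewrite /m; have [_|_] := leP x (Num.max y z); last by left.
  by right; have [_|_] := leP y z; [right|left].
- by rewrite -addrA lerDl addr_ge0.
- by rewrite addrAC lerDr addr_ge0.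
- by rewrite lerDr addr_ge0.
Qed.

End powers.

Section limits_of_integrals.
Local Open Scope ereal_scope.
Context d (T : measurableType d) (R : realType) (mu : {measure set T -> \bar R}).

Lemma fatou_le (f_ : (T -> \bar R)^nat) (f : T -> \bar R) (c : \bar R) :
  (forall n, measurable_fun [set: T] (f_ n)) -> measurable_fun [set: T] f ->
  (forall n x, 0 <= f_ n x) -> {ae mu, forall x, f_ ^~ x @ \oo --> f x} ->
  (forall n, \int[mu]_x f_ n x <= c) -> \int[mu]_x f x <= c.
Proof.
move=> mf_ mf f0 ff fc.
have -> : \int[mu]_x f x = \int[mu]_x limn_einf (f_ ^~ x).
  apply: ae_eq_integral => //; first exact/measurableT_comp/measurable_fun_limn_esup/(fun n => measurableT_comp _ (mf_ n)).
  apply: filterS ff => x fx _.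
  by rewrite is_cvg_limn_einfE; [exact/esym/cvg_lim|apply/cvg_ex; exists (f x)].
apply: le_trans (fatou _ _ _ _) _ => //.
rewrite limn_einf_lim; apply: lime_le; first exact: is_cvg_einfs.
apply: nearW => n; apply: le_trans (fc n).
by apply: ereal_inf_lbound; exists n => /=.
Qed.

End limits_of_integrals.

Section ereal_limits.
Local Open Scope ereal_scope.
Context {I : Type} {R : realType} (K : set_system I) {FK : ProperFilter K}.

Lemma cvg_EFin_comp (f : I -> R) (l : R) : f @ K --> l -> (f x)%:E @[x --> K] --> l%:E.
Proof. by move=> fl; apply: cvg_EFin => //; exact: nearW. Qed.

Lemma cvge0P (a : I -> \bar R) : (forall n, 0 <= a n) ->
  (a n @[n --> K] --> 0) <-> (forall e : R, (0 < e)%R -> \forall n \near K, a n <= e%:E).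
Proof.
move=> a0; split=> [/fine_cvgP[afin /cvgrPdist_le ac] e e0|ae].
  have ace := ac e e0; near=> n.
  have an : a n \is a fin_num by near: n.
  rewrite -(fineK an) lee_fin; apply: le_trans (ler_norm _) _.
  by rewrite -normrN -sub0r; near: n.
apply/fine_cvgP; split.
  have := ae 1%R ltr01; apply: filterS => n an.
  by rewrite ge0_fin_numE// (le_lt_trans an)// ltry.
apply/cvgrPdist_le => e e0; have := ae e e0; apply: filterS => n an.
rewrite sub0r normrN ger0_norm ?fine_ge0//.
by rewrite -lee_fin fineK// ge0_fin_numE// (le_lt_trans an)// ltry.
Unshelve. all: by end_near. Qed.

End ereal_limits.

(** * Continuity in L^p of a function along a path of Gaussian laws *)

Section gaussian_path.
Context {R : realType}.
Local Notation Rm := (measurableTypeR R).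
Local Notation gam := (@gam R).
Variables (C : set R) (b : R -> R).
Hypothesis cC : countable C.
Hypothesis cb : {within `[0, 1], continuous b}.
Hypothesis Cb1 : ~ C (b 1).

Definition gpath (t : R) (z : Rm) : Rm := aff (b t) (sdev t) z.

Lemma measurable_gpath t : measurable_fun [set: Rm] (gpath t).
Proof. exact: measurable_aff. Qed.

Lemma cvg_gpath (u : R^nat) (t z : R) : 0 <= t <= 1 ->
  (\forall n \near \oo, 0 <= u n <= 1) -> u n @[n --> \oo] --> t ->
  gpath (u n) z @[n --> \oo] --> gpath t z.
Proof.
move=> t01 u01 ut; apply: cvgD.
  have /subspace_continuousP/(_ t) := cb.
  rewrite /= in_itv/= => /(_ t01) ct.
  have ut' : u n @[n --> \oo] --> within `[0, 1]%classic (nbhs t).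
    move=> A /= /ut An.
    have An' : \forall n \near \oo, `[0, 1]%classic (u n) -> A (u n) by exact: An.
    by apply: (filterS2 _ _ An' u01) => n + un; apply; rewrite /= in_itv.
  exact: (cvg_comp _ _ ut' ct).
apply: cvgM; last exact: cvg_cst.
have ut1 : 1 - u n @[n --> \oo] --> 1 - t by apply: cvgB; [exact: cvg_cst|exact: ut].
exact: (cvg_comp _ _ ut1 (@sqrt_continuous R (1 - t))).
Qed.

(** Before time 1 the affine map is injective, so the preimage of C is countable and hence null. At
    time 1 the path sits at [b 1], which is where [Cb1] enters. *)
Lemma gpath_ae (t : R) : 0 <= t <= 1 -> {ae gam, forall z, ~ C (gpath t z)}.
Proof.
move=> /andP[t0]; rewrite le_eqVlt => /predU1P[->|t1].
  by apply: aeW => z; rewrite /gpath /sdev subrr sqrtr0 aff0.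
have s0 : sdev t != 0 by rewrite gt_eqF// sqrtr_gt0 subr_gt0.
pose D := [set (y - b t) / sdev t | y in C].
have cD : countable D by exact: sub_countable (card_image_le _ _) cC.
exists D; split.
- exact: countable_measurable.
- exact: gam_countable.
- move=> z /= /contrapT Cz; exists (gpath t z) => //.
  by rewrite /gpath /aff addrC addKr mulrC mulKf.
Qed.

(** Fatou's lemma along dyadic times tending to t: a bound at dyadic times, which is what Doob's
    inequality provides, extends to all of [0, 1]. *)
Lemma gint_lsc (g : R -> R) (c : \bar R) (t : R) :
  measurable_fun [set: Rm] (g : Rm -> Rm) -> (forall x, 0 <= g x) ->
  (forall x, ~ C x -> g y @[y --> x] --> g x) ->
  (forall m i, gint (EFin \o g) (dyad R m i) (b (dyad R m i)) <= c)%E ->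
  0 <= t <= 1 -> (gint (EFin \o g) t (b t) <= c)%E.
Proof.
move=> mg g0 cg gc t01; have /andP[t0 t1] := t01.
(* u m is t rounded down to the grid of mesh 2^-m; the cap at 1 is inactive there. *)
pose u m := dyad R m (Num.truncn (t * 2 ^+ m)).
have uE m : u m = (Num.truncn (t * 2 ^+ m))%:R / 2 ^+ m.
  rewrite /u /dyad min_l//; apply: le_trans t1.
  by rewrite ler_pdivrMr ?exprn_gt0// truncn_le// mulr_ge0// exprn_ge0.
have u_le m : u m <= t.
  by rewrite uE ler_pdivrMr ?exprn_gt0// truncn_le// mulr_ge0// exprn_ge0.
have u_ge m : t - 2^-1 ^+ m <= u m.
  rewrite uE lerBlDr -[2^-1 ^+ m]mul1r exprVn -mulrDl ler_pdivlMr ?exprn_gt0//.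
  by rewrite natr1 ltW// truncnS_gt.
have ut : u m @[m --> \oo] --> t.
  apply: (@squeeze_cvgr _ _ _ _ (fun m => t - 2^-1 ^+ m) (cst t)).
  - by apply: nearW => m; rewrite u_le u_ge.
  - rewrite -[X in _ --> X]subr0; apply: cvgB; first exact: cvg_cst.
    by apply: cvg_expr; rewrite ger0_norm ?invr_ge0// invf_lt1// ltr1n.
  - exact: cvg_cst.
have mgp s : measurable_fun [set: Rm] (fun z => (g (gpath s z))%:E).
  by apply/measurable_EFinP; exact: measurableT_comp mg (measurable_gpath s).
apply: (@fatou_le _ _ _ gam (fun m z => (g (gpath (u m) z))%:E)) => //.
- by move=> m; exact: mgp.
- by move=> m z; rewrite lee_fin.
- apply: filterS (gpath_ae t01) => z Cz; apply: cvg_EFin_comp.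
  have u01 : \forall m \near \oo, 0 <= u m <= 1 by apply: nearW => m; exact: dyad01.
  have cz := cvg_comp _ _ (@cvg_gpath u t z t01 u01 ut) (cg _ Cz).
  exact: cz.
- by move=> m; exact: gc.
Qed.


Variables (h : R -> R) (p : R).
Hypothesis mh : measurable_fun [set: Rm] (h : Rm -> Rm).
Hypothesis hC : forall x, ~ C x -> h y @[y --> x] --> h x.
Hypothesis p0 : 0 < p.

Definition ktail (n : nat) (x : R) : R := `|h x - clip n%:R (h x)| `^ p.

Lemma ktail_ge0 n x : 0 <= ktail n x. Proof. exact: powR_ge0. Qed.

Lemma measurable_clip n : measurable_fun [set: Rm] (fun x : Rm => clip n (h x) : Rm).
Proof.
apply: measurableT_comp mh.
by apply: continuous_measurable_fun; exact: continuous_clip.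
Qed.

Lemma measurable_ktail n : measurable_fun [set: Rm] (ktail n : Rm -> Rm).
Proof.
apply: (measurableT_comp (measurable_powR p)).
apply: (measurableT_comp (@normr_measurable R setT)).
by apply: measurable_funB => //; exact: measurable_clip.
Qed.

Lemma cvg_clip n x : ~ C x -> clip n (h y) @[y --> x] --> clip n (h x).
Proof. by move=> /hC hx; exact: (cvg_comp _ _ hx (@continuous_clip R n (h x))). Qed.

Lemma cvg_ktail n x : ~ C x -> ktail n y @[y --> x] --> ktail n x.
Proof.
move=> Cx.
have c1 : h y - clip n%:R (h y) @[y --> x] --> h x - clip n%:R (h x).
  by apply: cvgB; [exact: hC|exact: cvg_clip].
have c2 := @cvg_abs_powR R p (h x - clip n%:R (h x)) p0.
have c3 := cvg_comp _ _ c1 c2; exact: c3.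
Qed.

Lemma integral_ktail_cvg0 : (\int[gam]_x (`|h x| `^ p)%:E < +oo)%E ->
  (\int[gam]_x (ktail n x)%:E)%E @[n --> \oo] --> 0%E.
Proof.
move=> hoo; rewrite -[X in _ --> X](@integral0 _ _ _ gam setT).
have mhp : measurable_fun [set: Rm] (fun x : Rm => (`|h x| `^ p)%:E).
  exact: (measurableT_comp (measurable_abs_powR p) mh).
apply: (@dominated_cvg _ _ _ gam setT measurableT
  (fun n x => (ktail n x)%:E) (cst 0%E) (fun x => (`|h x| `^ p)%:E)) => //.
- by move=> n; apply/measurable_EFinP; exact: measurable_ktail.
- move=> x _; apply: cvg_near_cst; near=> n.
  rewrite /ktail clip_id ?subrr ?normr0 ?powR0 ?gt_eqF//.
  by near: n; exact: nbhs_infty_ger.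
- apply/integrableP; split => //.
  by under eq_integral do rewrite gee0_abs ?lee_fin ?powR_ge0//.
- move=> n x _; rewrite gee0_abs ?lee_fin ?ktail_ge0//.
  apply: (ge0_ler_powR (ltW p0)); rewrite ?nnegrE//.
  exact: clip_rem_le.
Unshelve. all: by end_near. Qed.

(** Uniform integrability of [|h| ^ p] along the path, in truncated form and at dyadic times
    only. *)
Definition tails_small := forall e : R, 0 < e -> exists n, forall m i,
  (gint (EFin \o ktail n) (dyad R m i) (b (dyad R m i)) <= e%:E)%E.

Hypothesis tails : tails_small.

(** h is split into its truncation at n and a remainder. The truncated part converges by dominated
    convergence, being bounded and continuous off C; the remainder is small uniformly in time, by
    [tails] and lower semicontinuity. *)
Lemma cvg_path_Lp (u : R^nat) (t : R) : 0 <= t <= 1 ->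
  (forall n, 0 <= u n <= 1) -> u n @[n --> \oo] --> t ->
  (\int[gam]_z (`|h (gpath (u n) z) - h (gpath t z)| `^ p)%:E)%E @[n --> \oo]
    --> 0%E.
Proof.
move=> t01 u01 ut.
have mhg s : measurable_fun [set: Rm] (fun z => h (gpath s z) : Rm).
  exact: (measurableT_comp mh (measurable_gpath s)).
have mcg n s : measurable_fun [set: Rm] (fun z => clip n%:R (h (gpath s z)) : Rm).
  exact: (measurableT_comp (measurable_clip n%:R) (measurable_gpath s)).
pose dif n s z := `|clip n%:R (h (gpath s z)) - clip n%:R (h (gpath t z))| `^ p.
have mdif n s : measurable_fun [set: Rm] (fun z => (dif n s z)%:E).
  apply: (measurableT_comp (measurable_abs_powR p)).
  by apply: measurable_funB; exact: mcg.
have dif_cvg n : (\int[gam]_z (dif n (u k) z)%:E)%E @[k --> \oo] --> 0%E.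
  rewrite -[X in _ --> X](@integral0 _ _ _ gam setT).
  have [] := @dominated_convergence _ _ _ gam setT measurableT
    (fun k z => (dif n (u k) z)%:E) (cst 0%E) (cst ((n%:R + n%:R) `^ p)%:E) => //.
  - apply: filterS (gpath_ae t01) => z Cz _; apply: cvg_EFin_comp.
    have u01' : \forall n \near \oo, 0 <= u n <= 1 by apply: nearW.
    have cz := cvg_comp _ _ (@cvg_gpath u t z t01 u01' ut) (@cvg_clip n%:R _ Cz).
    have cz' : clip n%:R (h (gpath (u k) z)) - clip n%:R (h (gpath t z))
        @[k --> \oo] --> (0 : R).
      rewrite -(subrr (clip n%:R (h (gpath t z)))).
      by apply: cvgB; [exact: cz|exact: cvg_cst].
    have := cvg_comp _ _ cz' (@cvg_abs_powR R p _ p0).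
    by rewrite normr0 powR0 ?gt_eqF.
  - exact: finite_measure_integrable_cst.
  - apply: aeW => z k _; rewrite gee0_abs ?lee_fin ?powR_ge0//.
    apply: (ge0_ler_powR (ltW p0)); rewrite ?nnegrE ?addr_ge0//.
    by apply: (le_trans (ler_normB _ _)); apply: lerD; exact: clip_le.
have tail_le n s e : (forall m i,
    (gint (EFin \o ktail n) (dyad R m i) (b (dyad R m i)) <= e%:E)%E) ->
    0 <= s <= 1 -> (\int[gam]_z (ktail n (gpath s z))%:E <= e%:E)%E.
  move=> ne s01; apply: (@gint_lsc (ktail n) e%:E s _ _ _ ne s01).
  - exact: measurable_ktail.
  - exact: ktail_ge0.
  - by move=> x; exact: cvg_ktail.
have bound n s : (\int[gam]_z (`|h (gpath s z) - h (gpath t z)| `^ p)%:E <=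
    (3 `^ p)%:E * (\int[gam]_z (dif n s z)%:E +
      \int[gam]_z (ktail n (gpath s z))%:E +
      \int[gam]_z (ktail n (gpath t z))%:E))%E.
  have mk s' : measurable_fun [set: Rm] (fun z => (ktail n (gpath s' z))%:E).
    apply/measurable_EFinP.
    exact: (measurableT_comp (measurable_ktail n) (measurable_gpath s')).
  have k0 s' z : (0 <= (ktail n (gpath s' z))%:E)%E by rewrite lee_fin ktail_ge0.
  have d0 z : (0 <= (dif n s z)%:E)%E by rewrite lee_fin powR_ge0.
  rewrite -ge0_integralD// -ge0_integralD//; first last.
  - exact: emeasurable_funD.
  - by move=> z _; exact: adde_ge0.
  rewrite -ge0_integralZl//; first last.
  - by move=> z _; rewrite !adde_ge0.
  - by apply: emeasurable_funD => //; exact: emeasurable_funD.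
  apply: ge0_le_integral => //.
  - apply: (measurableT_comp (measurable_abs_powR p)).
    by apply: measurable_funB; exact: mhg.
  - apply: measurable_funeM.
    by apply: emeasurable_funD => //; exact: emeasurable_funD.
  move=> z _; rewrite -!EFinD -EFinM lee_fin /dif /ktail.
  apply: le_powR3 => //.
  set x := h _; set y := h _; set cx := clip _ x; set cy := clip _ y.
  rewrite [X in `|X| <= _](_ : _ = (cx - cy) + (x - cx) - (y - cy)); last by ring.
  by apply: (le_trans (ler_normB _ _)); rewrite lerD2r ler_normD.
apply/cvge0P => [k|e e0]; first by apply: integral_ge0 => z _; rewrite lee_fin powR_ge0.
(* Three terms of size e' and the factor 3^p from [le_powR3] add up to e. *)
pose e' := e / (3 `^ p * 3).
have c30 : 0 < 3 `^ p * 3 :> R by rewrite mulr_gt0// powR_gt0.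
have e'0 : 0 < e' by rewrite divr_gt0.
have [n tn] := tails e'0.
have d0 k : (0 <= \int[gam]_z (dif n (u k) z)%:E)%E.
  by apply: integral_ge0 => z _; rewrite lee_fin powR_ge0.
have /(cvge0P d0)/(_ e' e'0) := dif_cvg n; apply: filterS => k dk.
apply: (le_trans (bound n (u k))).
apply: (@le_trans _ _ ((3 `^ p)%:E * (e'%:E + e'%:E + e'%:E))%E).
  apply: lee_wpmul2l; first by rewrite lee_fin powR_ge0.
  have k1 := tail_le n (u k) e' tn (u01 k); have k2 := tail_le n t e' tn t01.
  exact: (leeD (leeD dk k1) k2).
rewrite -!EFinD -EFinM lee_fin /e' le_eqVlt; apply/orP; left; apply/eqP.
by field; rewrite gt_eqF// powR_gt0.
Qed.

End gaussian_path.

Section wasserstein_facts.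
Context {R : realType}.
Local Notation Rm := (measurableTypeR R).
Local Open Scope ereal_scope.

Lemma wasserstein_pow_ge0 (p : R) (l m : probability Rm R) : 0 <= wasserstein_pow p l m.
Proof.
apply: le_ereal_inf_tmp => _ [pi _ <-]; apply: integral_ge0 => z _.
by rewrite lee_fin powR_ge0.
Qed.

Lemma wasserstein_pow_le d (T : measurableType d) (Q : probability T R) (p : R)
    (f g : T -> Rm) (l m : probability Rm R) :
  measurable_fun [set: T] f -> measurable_fun [set: T] g ->
  (forall A : set Rm, measurable A -> l A = Q (f @^-1` A)) ->
  (forall A : set Rm, measurable A -> m A = Q (g @^-1` A)) ->
  wasserstein_pow p l m <= \int[Q]_x (`|f x - g x| `^ p)%:E.
Proof.
move=> mf mg lf mg'.
have mfg : measurable_fun [set: T] (fun x => (f x, g x)) by exact: measurable_fun_pair.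
pose fg : {mfun T >-> (Rm * Rm)%type} :=
  HB.pack (fun x => (f x, g x)) (isMeasurableFun.Build _ _ _ _ _ mfg).
apply: ereal_inf_lbound; exists (distribution Q fg) => /=.
  move=> A mA; split; rewrite ?lf ?mg'//; congr (Q _).
    by apply/seteqP; split => x //= [].
  by apply/seteqP; split => x //= [].
rewrite ge0_integral_distribution//.
apply: (measurableT_comp (measurable_abs_powR p)).
by apply: measurable_funB; [exact: measurable_fst|exact: measurable_snd].
Qed.

Lemma wasserstein_cvg0 (p : R) (l_ : nat -> probability Rm R) (l : probability Rm R) :
  (0 < p)%R -> wasserstein_pow p (l_ n) l @[n --> \oo] --> 0 ->
  wasserstein p (l_ n) l @[n --> \oo] --> 0.
Proof.
move=> p0 /(cvge0P (fun n => wasserstein_pow_ge0 p (l_ n) l)) H.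
apply/cvge0P => [n|e e0]; first exact: poweR_ge0.
have ep0 : (0 < e `^ p)%R by rewrite powR_gt0.
apply: filterS (H _ ep0) => n Hn.
apply: (@le_trans _ _ (poweR (e `^ p)%:E p^-1)).
  apply: gt0_ler_poweR => //; first by rewrite invr_ge0 ltW.
  - by rewrite in_itv/= leey wasserstein_pow_ge0.
  - by rewrite in_itv/= leey lee_fin ltW.
by rewrite poweR_EFin -powRrM mulfV ?gt_eqF// powRr1// ltW.
Qed.

End wasserstein_facts.

Section bass_cadlag.
Context (R : realType) (d : measure_display) (T : measurableType d).
Variables (P : probability T R) (F : R -> set (set T)) (B : R -> T -> R).
Local Notation Rm := (measurableTypeR R).
Local Notation gam := (@gam R).
Hypothesis filtF : filtration F.
Hypothesis bmB : brownian_motion P F B.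
Variables (mu : probability Rm R) (p : R).
Hypothesis p1 : 1 <= p.
Hypothesis pmu : finite_moment p mu.
Local Notation h := (bass_map mu).
Local Notation xi := (bass_mvm mu B).

Let p0 : 0 < p. Proof. exact: lt_le_trans p1. Qed.

Lemma bass_mvm_gpath t o (A : set Rm) : 0 <= t <= 1 -> measurable A ->
  xi t o A = gam ((fun z => h (gpath (B ^~ o) t z)) @^-1` A).
Proof.
move=> t01 mA; have mhA : measurable (h @^-1` A : set Rm).
  by rewrite -[X in measurable X]setTI; exact: measurable_bass_map.
exact: (eta_gam B o t01 mhA).
Qed.

Variable C : set R.
Hypothesis cC : countable C.
Hypothesis hC : forall x, ~ C x -> h y @[y --> x] --> h x.

Lemma integral_bass_map_moment : (\int[gam]_x (`|h x| `^ p)%:E < +oo)%E.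
Proof.
apply: le_lt_trans pmu.
have -> : (\int[mu]_x (`|x| `^ p)%:E =
           \int[distribution gam h]_x (`|x| `^ p)%:E)%E.
  apply: eq_measure_integral => A mA _; exact/esym/bass_map_distribution.
rewrite ge0_integral_distribution//; exact: measurable_abs_powR.
Qed.

Lemma brownian_avoids_countable : {ae P, forall o, ~ C (B 1 o)}.
Proof.
have [_ B0 _ lawB _] := bmB.
have mC : measurable (C : set Rm) by exact: countable_measurable.
exists (increment B 0 1 @^-1` C); split.
- rewrite -[X in measurable X]setTI.
  apply: measurable_funB => //; apply: (brownian_measurable filtF bmB).
    by rewrite ler01 lexx.
  by rewrite ler01 lexx.
- apply: etrans (lawB _ _ (lexx _) ltr01 (lexx _) _ mC) _.
  by rewrite subr0 sqrtr1; exact: gam_countable.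
- by move=> o /= /contrapT; rewrite /increment B0 subr0.
Qed.

(** At level 1/(j + 1), Doob's inequality bounds the probability that tail n is exceeded by j + 1
    times its [gam]-integral, which vanishes as n grows. So for each j it is a null event that every
    n is exceeded, and countably many levels suffice. *)
Lemma tails_small_ae : {ae P, forall o, tails_small (B ^~ o) h p}.
Proof.
have mk n : measurable_fun [set: Rm] (EFin \o ktail h p n).
  by apply/measurable_EFinP; apply: measurable_ktail; exact: measurable_bass_map.
have k0 n x : (0 <= (EFin \o ktail h p n) x)%E by rewrite lee_fin ktail_ge0.
pose E j n := exceed_dyadic B (EFin \o ktail h p n) (j.+1%:R^-1 : R).
have j0 j : 0 < j.+1%:R^-1 :> R by rewrite invr_gt0.
have mE j n : measurable (E j n).
  by apply: (exceed_dyadic_measurable filtF bmB).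
have kcvg := @integral_ktail_cvg0 R h p (measurable_bass_map mu) p0 integral_bass_map_moment.
have PE j : P (\bigcap_n E j n) = 0%E.
  apply/eqP; rewrite eq_le measure_ge0 andbT.
  suff : ((j.+1%:R^-1)%:E * P (\bigcap_n E j n) <= 0)%E by rewrite pmule_rle0 ?lte_fin.
  apply: (cvge_to_ge kcvg); apply: nearW => n.
  apply: le_trans (doob_dyadic filtF bmB (mk n) (k0 n) (j0 j)).
  apply: lee_wpmul2l; first by rewrite lee_fin ltW.
  apply: le_measure; rewrite ?inE//; [exact: bigcapT_measurable|exact: mE|].
  by move=> o; apply.
have NE : P.-negligible (\bigcup_j \bigcap_n E j n).
  apply: negligible_bigcup => j; apply/negligibleP; last exact: PE.
  exact: bigcapT_measurable.
apply: negligibleS NE => o /=.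
apply: contra_notP => Eo e e0.
  have [j je] : exists j, j.+1%:R^-1 <= e.
    exists (Num.truncn e^-1).
    by rewrite invf_ple ?posrE// ltW// truncnS_gt.
  have [n En] : exists n, ~ E j n o.
    by apply/existsNP => En; apply: Eo; exists j.
  exists n => m i; rewrite leNgt; apply/negP => em; apply: En; exists m => //; exists i => //.
  by apply: le_lt_trans em; rewrite lee_fin.
Qed.

Lemma cadlag_bass o : {within `[0, 1], continuous (B ^~ o)} -> ~ C (B 1 o) ->
  tails_small (B ^~ o) h p -> cadlag_wasserstein p (xi ^~ o).
Proof.
move=> cB CB1 tB.
have seq_cvg (u : R^nat) (t : R) : 0 <= t <= 1 -> (forall n, 0 <= u n <= 1) ->
    u n @[n --> \oo] --> t ->
    wasserstein p (xi (u n) o) (xi t o) @[n --> \oo] --> 0%E.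
  move=> t01 u01 ut; apply: wasserstein_cvg0 => //.
  have mhg s : measurable_fun [set: Rm] (fun z => h (gpath (B ^~ o) s z)).
    exact: (measurableT_comp (measurable_bass_map mu) (measurable_gpath (B ^~ o) s)).
  have L := cvg_path_Lp cC cB CB1 (measurable_bass_map mu) hC p0 tB t01 u01 ut.
  have I0 n : (0 <= \int[gam]_z (`|h (gpath (B ^~ o) (u n) z) - h (gpath (B ^~ o) t z)| `^ p)%:E)%E.
    by apply: integral_ge0 => z _; rewrite lee_fin powR_ge0.
  apply/cvge0P => [n|e e0]; first exact: wasserstein_pow_ge0.
  have /(cvge0P I0)/(_ e e0) := L; apply: filterS => n; apply: le_trans.
  apply: (wasserstein_pow_le p (mhg (u n)) (mhg t)) => A mA.
    exact: bass_mvm_gpath.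
  exact: bass_mvm_gpath.
split.
- by move=> t t01; exact: (finite_moment_bass bmB o pmu t01).
- move=> t /andP[t0 t1]; apply/cvge_at_rightP => u [ut cut].
  have t01 : 0 <= t <= 1 by rewrite t0 ltW.
  (* A sequence tending to t from the right may leave [0, 1] at finitely many indices; the cap
     changes only those. *)
  pose v n := Num.min (u n) 1.
  have v01 n : 0 <= v n <= 1.
    by rewrite /v le_min ge_min lexx orbT ler01 !andbT (le_trans t0)// ltW.
  have uv : \forall n \near \oo, v n = u n.
    near=> n; rewrite /v min_l//; apply: ltW; near: n.
    exact: (cvgr_lt _ cut).
  have cv : v n @[n --> \oo] --> t.
    by apply: cvg_trans cut; apply: near_eq_cvg; apply: filterS uv.
  apply: cvg_trans (seq_cvg v t t01 v01 cv); apply: near_eq_cvg.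
  by apply: filterS uv => n ->.
- move=> t /andP[t0 t1]; have t01 : 0 <= t <= 1 by rewrite t1 ltW.
  (* The path is continuous for W_p, so its left limit at t is its value there. *)
  exists (xi t o); first exact: (finite_moment_bass bmB o pmu t01).
  apply/cvge_at_leftP => u [ut cut].
  pose v n := Num.max (u n) 0.
  have v01 n : 0 <= v n <= 1.
    by rewrite /v le_max ge_max lexx orbT ler01 /= andbT (le_trans _ t1)// ltW.
  have uv : \forall n \near \oo, v n = u n.
    near=> n; rewrite /v max_l//; apply: ltW; near: n.
    exact: (cvgr_gt _ cut).
  have cv : v n @[n --> \oo] --> t.
    by apply: cvg_trans cut; apply: near_eq_cvg; apply: filterS uv.
  apply: cvg_trans (seq_cvg v t t01 v01 cv); apply: near_eq_cvg.
  by apply: filterS uv => n ->.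
Unshelve. all: by end_near. Qed.

End bass_cadlag.

Lemma mvm_from_bass (R : realType) (d : measure_display) (T : measurableType d)
    (P : probability T R) (F : R -> set (set T)) (B : R -> T -> R)
    (p : R) (mu : probability (measurableTypeR R) R) :
  filtration F -> brownian_motion P F B -> 1 <= p -> finite_moment p mu ->
  mvm_from P F p mu (bass_mvm mu B).
Proof.
move=> filtF bmB p1 pmu; split.
- exact: (measure_valued_martingale_bass filtF bmB p1 pmu).
- have [C cC hC] := nondecreasing_continuous_off_countable (@nondecreasing_bass_map _ mu).
  have [_ _ cB _ _] := bmB.
  have bC := brownian_avoids_countable filtF bmB cC.
  have tB := tails_small_ae filtF bmB p1 pmu.
  by apply: filterS3 cB bC tB => o; exact: (cadlag_bass bmB p1 pmu cC hC).
- by apply: aeW => o A mA; exact: (bass_mvm_0 bmB).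
Qed.

(** * Dual potentials *)

Section hinge.
Context {R : realType} (p : R).
Hypothesis p1 : 1 <= p.
Local Notation Rm := (measurableTypeR R).
Local Notation leb := (@lebesgue_measure R).

Let p0 : 0 < p. Proof. exact: lt_le_trans p1. Qed.

(** The increasing half of [|z| ^ p]. Its slope is nonnegative, so potentials can be built from
    integrals of nonnegative functions. *)
Definition hinge (z : R) : R := (Num.max z 0) `^ p.
(** The right derivative of [hinge], monotone because [hinge] is convex. For p = 1 its value at 0 is
    1, as 0 to the power 0 is 1. *)
Definition dhinge (z : R) : R := if z < 0 then 0 else p * z `^ (p - 1).

Lemma hinge_ge0 z : 0 <= hinge z. Proof. exact: powR_ge0. Qed.

Lemma dhinge_ge0 z : 0 <= dhinge z.
Proof. by rewrite /dhinge; case: ifP => // _; rewrite mulr_ge0 ?powR_ge0// ltW. Qed.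

Lemma dhinge_nd : {homo dhinge : x y / x <= y}.
Proof.
move=> x y xy; rewrite {1}/dhinge; case: ltP => x0; first exact: dhinge_ge0.
rewrite /dhinge ltNge (le_trans x0 xy)/= (ler_wpM2l (ltW p0))//.
by apply: ge0_ler_powR; rewrite ?nnegrE ?subr_ge0// (le_trans x0).
Qed.

Lemma hinge_nd : {homo hinge : x y / x <= y}.
Proof.
move=> x y xy; apply: (ge0_ler_powR (ltW p0)).
- by rewrite nnegrE le_max lexx orbT.
- by rewrite nnegrE le_max lexx orbT.
have [_|_] := leP x 0; first by rewrite le_max lexx orbT.
by rewrite le_max xy.
Qed.

Lemma hinge_pos z : 0 <= z -> hinge z = z `^ p.
Proof. by move=> z0; rewrite /hinge max_l. Qed.

Lemma hinge_neg z : z <= 0 -> hinge z = 0.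
Proof. by move=> z0; rewrite /hinge max_r// powR0// gt_eqF. Qed.

Lemma hinge_sum z : hinge z + hinge (- z) = `|z| `^ p.
Proof.
have [z0|z0] := leP 0 z.
  by rewrite hinge_pos// hinge_neg ?oppr_le0// addr0 ger0_norm.
by rewrite hinge_neg ?ltW// hinge_pos ?oppr_ge0 ?ltW// add0r ltr0_norm.
Qed.

Lemma measurable_dhinge : measurable_fun [set: Rm] (dhinge : Rm -> Rm).
Proof. by apply: nondecreasing_measurable => //; exact: dhinge_nd. Qed.

Lemma within_continuous_powR (q b : R) : 0 <= q ->
  {within `[0, b], continuous (fun s : R => s `^ q)}.
Proof.
rewrite le_eqVlt => /predU1P[<-|q0].
  rewrite (_ : (fun s => _) = cst 1); last by apply/funext => s; rewrite powRr0.
  by apply: continuous_subspaceT => x; exact: cvg_cst.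
have c : {within `[0, b], continuous (fun s : R => `|s| `^ q)}.
  by apply: continuous_subspaceT => x; exact: cvg_abs_powR.
apply: (subspace_eq_continuous _ c) => x; rewrite inE/= in_itv/= => /andP[x0 _].
by rewrite /from_subspace/= ger0_norm.
Qed.

Lemma integral_powR (b : R) : 0 < b ->
  (\int[leb]_(s in `[0%R, b]) (p * s `^ (p - 1))%:E = (b `^ p)%:E)%E.
Proof.
move=> b0; have cp := @within_continuous_powR p b (ltW p0).
have /(continuous_within_itvP _ b0)[c1 c2 c3] := cp.
have := @continuous_FTC2 _ (fun s => p * s `^ (p - 1)) (fun s => s `^ p) 0 b b0.
rewrite powR0 ?gt_eqF// sube0; apply.
- have pm1 : 0 <= p - 1 by rewrite subr_ge0.
  have cm := @within_continuous_powR (p - 1) b pm1.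
  by move=> x; apply: cvgM; [exact: cvg_cst|exact: cm].
- split => //.
  move=> x; rewrite in_itv/= => /andP[x0 _]; apply: derivable_powR.
  by rewrite in_itv/= x0.
- move=> x; rewrite in_itv/= => /andP[x0 _]; apply: powR_derive1.
  by rewrite in_itv/= x0.
Qed.

Lemma integral_dhinge_ray b : (\int[leb]_(s in `]-oo, b]) (dhinge s)%:E = (hinge b)%:E)%E.
Proof.
have neg0 c : c <= 0 -> (\int[leb]_(s in `]-oo, c[) (dhinge s)%:E = 0)%E.
  move=> c0; apply: integral0_eq => s; rewrite /= in_itv/= => sc.
  by rewrite /dhinge (lt_le_trans sc c0).
have [b0|b0] := ltP 0 b; last first.
  rewrite hinge_neg// -integral_itv_bndo_bndc ?neg0//.
  by apply/measurable_EFinP/measurable_funTS; exact: measurable_dhinge.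
have -> : `]-oo, b]%classic = `]-oo, 0[ `|` `[0, b] :> set R.
  apply/seteqP; split => x /=; rewrite !in_itv/=.
    by move=> xb; case: (ltP x 0) => x0; [left|right].
  by move=> [x0|/andP[]//]; rewrite ltW// (lt_trans x0).
rewrite ge0_integral_setU//=; last 3 first.
- by apply/measurable_EFinP/measurable_funTS; exact: measurable_dhinge.
- by move=> s _; rewrite lee_fin dhinge_ge0.
- apply/disj_setPS => x /=; rewrite !in_itv/= => -[x0 /andP[]].
  by rewrite leNgt x0.
rewrite neg0// add0e hinge_pos ?ltW// -integral_powR//.
apply: eq_integral => s; rewrite inE/= in_itv/= => /andP[s0 _].
by rewrite /dhinge ltNge s0.
Qed.

(** Obtained by subtracting two rays, which avoids discussing on which side of u and v the kink at y
    lies. *)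
Lemma integral_dhinge (u v y : R) : u <= v ->
  (\int[leb]_(s in `]u, v]) (dhinge (s - y))%:E = (hinge (v - y) - hinge (u - y))%:E)%E.
Proof.
move=> uv.
have md : measurable_fun [set: Rm] (fun s : Rm => (dhinge (s - y))%:E).
  apply/measurable_EFinP; apply: (measurableT_comp measurable_dhinge).
  exact: measurable_funB.
have ray b : (\int[leb]_(s in `]-oo, b]) (dhinge (s - y))%:E = (hinge (b - y))%:E)%E.
  rewrite integral_mkcond (@ge0_integral_aff _ y 1)//; last 2 first.
  - by apply/(measurable_restrictT _ _).1 => //; exact: measurable_funTS.
  - by move=> x; rewrite patchE; case: ifP => // _; rewrite lee_fin dhinge_ge0.
  rewrite mul1e -integral_dhinge_ray [RHS]integral_mkcond; apply: eq_integral => z _.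
  rewrite !patchE /aff mul1r addrAC subrr add0r.
  congr (if _ then _ else _); apply/idP/idP; rewrite !inE/= !in_itv/=.
    by rewrite lerBrDl.
  by rewrite lerBrDl.
have : (hinge (v - y))%:E = ((hinge (u - y))%:E +
    \int[leb]_(s in `]u, v]) (dhinge (s - y))%:E)%E.
  rewrite -!ray.
  have -> : `]-oo, v]%classic = `]-oo, u] `|` `]u, v] :> set R.
    apply/seteqP; split => x /=; rewrite !in_itv/=.
      by move=> xb; case: (leP x u) => x0; [left|right].
    by move=> [x0|/andP[]//]; rewrite (le_trans x0).
  rewrite ge0_integral_setU//=.
  - exact: measurable_funTS.
  - by move=> s _; rewrite lee_fin dhinge_ge0.
  - apply/disj_setPS => x /=; rewrite !in_itv/= => -[x0 /andP[]].
    by rewrite ltNge x0.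
(* Infinite values of the integral are excluded, since adding it to a real number gives a real
   number. *)
case: (integral _ _ _) => [r [->]| |] //.
by congr (_%:E); rewrite addrC addrK.
Qed.

End hinge.

Section clip_order.
Context {R : realType}.
Implicit Types N x y : R.

Lemma clip_nd N : {homo clip N : x y / x <= y}.
Proof.
move=> x y xy; rewrite /clip.
have mxy : Num.min N x <= Num.min N y.
  by rewrite le_min !ge_min lexx xy orbT.
by rewrite ge_max !le_max lexx mxy orbT.
Qed.

Lemma clip_dist N x y : x <= y -> clip N y - clip N x <= y - x.
Proof.
move=> xy; rewrite /clip.
case: (leP N x) => Nx; case: (leP N y) => Ny;
  case: (leP (- N) N) => NN; case: (leP (- N) x) => Nx'; case: (leP (- N) y) => Ny';
  rewrite ?[Num.max _ N]max_r ?[Num.max _ N]max_l//; lra.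
Qed.

Lemma clip_in N x : 0 <= N -> - N <= clip N x <= N.
Proof. by move=> N0; rewrite -ler_norml clip_le. Qed.

Lemma clip_above N x : - N <= x -> clip N x <= x.
Proof. by move=> Nx; rewrite /clip ge_max Nx ge_min lexx orbT. Qed.

Lemma clip_below N x : x <= N -> x <= clip N x.
Proof. by move=> xN; rewrite /clip le_max le_min xN lexx orbT. Qed.

End clip_order.

Section hinge_potentials.
Context {R : realType} (p N : R) (h : R -> R).
Hypotheses (p1 : 1 <= p) (N0 : 0 <= N) (ndh : {homo h : x y / x <= y}).
Local Notation Rm := (measurableTypeR R).
Local Notation leb := (@lebesgue_measure R).
Local Notation hinge := (hinge p).
Local Notation dhinge := (dhinge p).

Let H x := clip N (h x).
Let g s := dhinge (s - H s).
(** For s <= N the argument s - H s is at most N + N, so by monotonicity K bounds the slope of J; it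
    is the Lipschitz constant of both potentials. *)
Let K := dhinge (N + N).

Let K0 : 0 <= K. Proof. exact: dhinge_ge0. Qed.

Let mg : measurable_fun [set: Rm] (EFin \o g : Rm -> \bar R).
Proof.
apply/measurable_EFinP; apply: (measurableT_comp (measurable_dhinge p1)).
apply: measurable_funB => //.
by apply: nondecreasing_measurable => // x y xy; apply: clip_nd; exact: ndh.
Qed.

Let g0 s : (0 <= (g s)%:E)%E. Proof. by rewrite lee_fin dhinge_ge0. Qed.

Let I (u v : R) : \bar R := (\int[leb]_(s in `]u, v]) (g s)%:E)%E.

Let I_ge0 u v : (0 <= I u v)%E. Proof. by apply: integral_ge0 => s _; exact: g0. Qed.

Let I_le u v : u <= v -> v <= N -> (I u v <= (K * (v - u))%:E)%E.
Proof.
move=> uv vN.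
have -> : ((K * (v - u))%:E = \int[leb]_(s in `]u, v]) K%:E)%E.
  rewrite integral_cst//= lebesgue_measure_itv/= lte_fin.
  move: uv; rewrite le_eqVlt => /predU1P[->|uv].
    by rewrite ltxx mule0 subrr mulr0.
  by rewrite uv -EFinB -EFinM.
apply: ge0_le_integral => //; first exact: measurable_funTS.
move=> s; rewrite /= in_itv/= => /andP[_ sv]; rewrite lee_fin; apply: dhinge_nd => //.
have /andP[H1 _] := clip_in (h s) N0.
by apply: lerD; [exact: le_trans vN|rewrite lerNl].
Qed.

Let I_cat u v w : u <= v -> v <= w -> (I u w = I u v + I v w)%E.
Proof.
move=> uv vw; rewrite /I.
have -> : `]u, w]%classic = `]u, v] `|` `]v, w] :> set R.
  apply/seteqP; split => x /=; rewrite !in_itv/=.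
    by move=> /andP[ux xw]; case: (leP x v) => x0; [left|right]; rewrite ?ux.
  move=> [/andP[-> xv]|/andP[vx ->]] /=; first exact: le_trans vw.
  by rewrite andbT (le_lt_trans uv).
rewrite ge0_integral_setU//=.
- exact: measurable_funTS.
- apply/disj_setPS => x /=; rewrite !in_itv/= => -[/andP[_ x0] /andP[]].
  by rewrite ltNge x0.
Qed.

(* A dual potential paired at x with [h x] must have slope [dhinge (x - h x)]
   there, so J is the only candidate up to a constant; [psi] below is its
   transform for the cost [hinge]. *)
Let J u := fine (I (- N) u).

Let J_diff u v : - N <= u -> u <= v -> v <= N -> ((J v - J u)%:E = I u v)%E.
Proof.
move=> Nu uv vN.
have fin a b : a <= b -> b <= N -> I a b \is a fin_num.
  by move=> ab bN; rewrite ge0_fin_numE// (le_lt_trans (I_le ab bN))// ltry.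
rewrite EFinB /J !fineK ?fin//; [|exact: le_trans uv vN|exact: le_trans uv].
rewrite (I_cat Nu uv) addeAC subee ?add0e// fin//; exact: le_trans uv vN.
Qed.

Let J_nd u v : - N <= u -> u <= v -> v <= N -> J u <= J v.
Proof. by move=> Nu uv vN; rewrite -subr_ge0 -lee_fin J_diff. Qed.

Let J_lip u v : - N <= u -> u <= v -> v <= N -> J v - J u <= K * (v - u).
Proof. by move=> Nu uv vN; rewrite -lee_fin J_diff// I_le. Qed.

Let J_upper u v y : - N <= u -> u <= v -> v <= N ->
  (forall s, u < s -> s <= v -> y <= H s) ->
  J v - J u <= hinge (v - y) - hinge (u - y).
Proof.
move=> Nu uv vN yH; rewrite -lee_fin J_diff// -integral_dhinge//.
apply: ge0_le_integral => //.
- exact: measurable_funTS.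
- apply/measurable_EFinP/measurable_funTS.
  apply: (measurableT_comp (measurable_dhinge p1)); exact: measurable_funB.
- move=> s; rewrite /= in_itv/= => /andP[us sv]; rewrite lee_fin.
  by apply: dhinge_nd => //; rewrite lerD2l lerN2 yH.
Qed.

Let J_lower u v y : - N <= u -> u <= v -> v <= N ->
  (forall s, u < s -> s <= v -> H s <= y) ->
  hinge (v - y) - hinge (u - y) <= J v - J u.
Proof.
move=> Nu uv vN yH; rewrite -lee_fin J_diff// -integral_dhinge//.
apply: ge0_le_integral => //.
- by move=> s _; rewrite lee_fin dhinge_ge0.
- apply/measurable_EFinP/measurable_funTS.
  apply: (measurableT_comp (measurable_dhinge p1)); exact: measurable_funB.
- exact: measurable_funTS.
- move=> s; rewrite /= in_itv/= => /andP[us sv]; rewrite lee_fin.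
  by apply: dhinge_nd => //; rewrite lerD2l lerN2 yH.
Qed.

Let J_bound u : - N <= u <= N -> 0 <= J u <= K * (N + N).
Proof.
move=> /andP[Nu uN]; apply/andP; split; first by apply: fine_ge0; exact: I_ge0.
have J0 : J (- N) = 0.
  by rewrite /J /I set_itv_ge ?bnd_simp ?ltxx// integral_set0.
have := J_lip (lexx _) Nu uN; rewrite J0 subr0 => /le_trans; apply.
by rewrite ler_wpM2l// opprK lerD2r.
Qed.

Let hinge_lip a b : a <= b -> b <= N + N -> hinge b - hinge a <= K * (b - a).
Proof.
move=> ab bN; have := integral_dhinge p1 0 ab; rewrite !subr0 => E.
rewrite -lee_fin -E.
have -> : ((K * (b - a))%:E = \int[leb]_(s in `]a, b]) K%:E)%E.
  rewrite integral_cst//= lebesgue_measure_itv/= lte_fin.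
  move: ab; rewrite le_eqVlt => /predU1P[->|uv].
    by rewrite ltxx mule0 subrr mulr0.
  by rewrite uv -EFinB -EFinM.
apply: ge0_le_integral => //.
- by move=> s _; rewrite lee_fin dhinge_ge0.
- apply/measurable_EFinP/measurable_funTS.
  apply: (measurableT_comp (measurable_dhinge p1)); exact: measurable_funB.
- move=> s; rewrite /= in_itv/= subr0 => /andP[_ sb]; rewrite lee_fin.
  by apply: dhinge_nd => //; exact: le_trans bN.
Qed.

Let A y := [set hinge (u - clip N y) - J u | u in [set u | - N <= u <= N]].
Let psi y := inf (A y).

Let A_neq0 y : A y !=set0.
Proof.
by exists (hinge (- N - clip N y) - J (- N)); exists (- N) => //=; rewrite lexx ge0_cp.
Qed.

Let A_lb y : lbound (A y) (- (K * (N + N))).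
Proof.
move=> _ [u uN <-]; have /andP[_ Pu] := J_bound uN.
by have h0 := hinge_ge0 p (u - clip N y); lra.
Qed.

(** The upper inequality comes from the infimum defining [psi] and from clipping, which can only
    lower the hinge cost. The last clause says that, at y = h x, this infimum is attained at u =
    [clip N x]. Indeed J has slope dhinge (s - H s), and monotonicity of H compares it with the
    slope dhinge (s - H x) of the cost: it is larger to the left of x and smaller to the right, so
    moving u away from [clip N x] never lowers the value. *)
Lemma hinge_potentials : exists phi psi : R -> R,
  [/\ exists L, forall x y, `|phi x - phi y| <= L * `|x - y|,
      exists L, forall x y, `|psi x - psi y| <= L * `|x - y|,
      exists M, forall x, `|phi x| <= M /\ `|psi x| <= M,
      forall x y, phi x + psi y <= hinge (x - y) &
      forall x, hinge (clip N x - clip N (h x)) <= phi x + psi (h x)].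
Proof.
have cl x := clip_in x N0.
have A_inf y u : - N <= u <= N -> psi y <= hinge (u - clip N y) - J u.
  by move=> uN; apply: ge_inf; [exists (- (K * (N + N))); exact: A_lb|exists u].
have le_psi y r : (forall u, - N <= u <= N -> r <= hinge (u - clip N y) - J u) ->
    r <= psi y.
  by move=> ru; apply: lb_le_inf; [exact: A_neq0|move=> _ [u uN <-]; exact: ru].
exists (J \o clip N), psi; split.
- exists K => x y; wlog xy : x y / x <= y => [hw|].
    have [xy|/ltW yx] := leP x y; first exact: hw.
    by rewrite distrC (distrC x); exact: hw.
  have /andP[x1 _] := cl x; have /andP[_ y2] := cl y; have cxy := clip_nd N xy.
  rewrite distrC ger0_norm ?subr_ge0; last exact: J_nd.
  apply: (le_trans (J_lip x1 cxy y2)).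
  rewrite ler_wpM2l// distrC ger0_norm ?subr_ge0//; exact: clip_dist.
- exists K => x y; wlog xy : x y / x <= y => [hw|].
    have [xy|/ltW yx] := leP x y; first exact: hw.
    by rewrite distrC (distrC x); exact: hw.
  have cxy := clip_nd N xy; have dxy := clip_dist N xy.
  have nd : psi y <= psi x.
    apply: le_psi => u uN; apply: (le_trans (A_inf y u uN)).
    by rewrite lerD2r hinge_nd// lerD2l lerN2.
  rewrite ger0_norm ?subr_ge0// distrC ger0_norm ?subr_ge0//.
  rewrite lerBlDr -lerBlDl; apply: le_psi => u uN.
  rewrite lerBlDr; apply: (le_trans (A_inf x u uN)).
  have /andP[_ uN'] := uN; have /andP[xN _] := cl x.
  rewrite addrAC lerD2r addrC -lerBlDr.
  apply: (@le_trans _ _ (K * ((u - clip N x) - (u - clip N y)))).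
    apply: hinge_lip; first by rewrite lerD2l lerN2.
    by apply: lerD => //; rewrite lerNl.
  by rewrite ler_wpM2l//; lra.
- exists (K * (N + N) + hinge (N + N)) => x; split.
    have /andP[P1 P2] := J_bound (cl x).
    by rewrite /= ger0_norm// (le_trans P2)// lerDl hinge_ge0.
  rewrite ler_norml; apply/andP; split.
    apply: le_psi => u uN; have /andP[_ Pu] := J_bound uN.
    have := hinge_ge0 p (u - clip N x); have := hinge_ge0 p (N + N); lra.
  have NN : - N <= N <= N by rewrite lexx andbT ge0_cp.
  apply: (le_trans (A_inf x N NN)).
  have /andP[PN _] := J_bound NN.
  have : hinge (N - clip N x) <= hinge (N + N).
    by apply: hinge_nd => //; rewrite lerD2l lerNl; have /andP[] := cl x.
  have : 0 <= K * (N + N) by rewrite mulr_ge0// addr_ge0.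
  lra.
- move=> x y /=.
  have Axy := A_inf y (clip N x) (cl x).
  apply: (@le_trans _ _ (hinge (clip N x - clip N y))); first lra.
  have [yx|xy] := leP y x.
    by apply: hinge_nd => //; exact: clip_dist.
  by rewrite hinge_neg ?hinge_ge0// subr_le0 clip_nd// ltW.
- move=> x /=; rewrite -lerBlDl; apply: le_psi => u uN.
  have /andP[u1 u2] := uN; have /andP[x1 x2] := cl x.
  have [ux|xu] := leP u (clip N x).
    suff Hs s : u < s -> s <= clip N x -> H s <= H x.
      by have := J_lower u1 ux x2 Hs; rewrite /H; lra.
    move=> us sx.
    (* Clipping moves x up only when x < - N; then [clip N x] is - N <= u and there is no s to
       consider. *)
    apply: clip_nd; apply: ndh; apply: (le_trans sx); apply: clip_above.
    rewrite leNgt; apply/negP => xN; move: sx; rewrite {1}/clip min_r; last first.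
      by rewrite ltW// (lt_le_trans xN)// ge0_cp.
    by rewrite (max_l (ltW xN)) leNgt => /negP; apply; exact: le_lt_trans us.
  suff Hs s : clip N x < s -> s <= u -> H x <= H s.
    by have := J_upper x1 (ltW xu) u2 Hs; rewrite /H; lra.
  move=> xs su.
  apply: clip_nd; apply: ndh; apply: le_trans (ltW xs); apply: clip_below.
  rewrite leNgt; apply/negP => Nx; move: xs; rewrite /clip (min_l (ltW Nx)).
  rewrite max_r ?ge0_cp// ltNge => /negP; apply; exact: le_trans su u2.
Qed.

End hinge_potentials.

Section dual_potentials.
Context {R : realType} (p N : R) (h : R -> R).
Hypotheses (p1 : 1 <= p) (N0 : 0 <= N) (ndh : {homo h : x y / x <= y}).

Lemma clipN x : clip N (- x) = - clip N x.
Proof.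
have NN : - N <= N by rewrite ge0_cp.
rewrite /clip; have [Nx|xN] := leP N x.
  have xN : - x <= - N by rewrite lerN2.
  by rewrite (max_r NN) (min_r (le_trans xN NN)) (max_l xN).
have [Nx|xN'] := leP (- N) x.
  have xN' : - N <= - x by rewrite lerN2 ltW.
  have Nx' : - x <= N by rewrite lerNl.
  by rewrite (min_r Nx') (max_r xN').
have Nx : N <= - x by rewrite lerNr ltW.
by rewrite (min_l Nx) (max_r NN) opprK.
Qed.

(* The potentials for [|x - y|^p] add those for its increasing part
   [hinge (x - y)] and, by reflection, those for [hinge (y - x)]. *)
Lemma dual_potentials : exists phi psi : R -> R,
  [/\ exists L, forall x y, `|phi x - phi y| <= L * `|x - y|,
      exists L, forall x y, `|psi x - psi y| <= L * `|x - y|,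
      exists M, forall x, `|phi x| <= M /\ `|psi x| <= M,
      forall x y, phi x + psi y <= `|x - y| `^ p &
      forall x, `|clip N x - clip N (h x)| `^ p <= phi x + psi (h x)].
Proof.
have ndh' : {homo (fun x => - h (- x)) : x y / x <= y}.
  by move=> x y xy; rewrite lerN2 ndh// lerN2.
have [f1 [g1 [[a1 Lf1] [b1 Lg1] [M1 B1] U1 D1]]] := hinge_potentials p1 N0 ndh.
have [f2 [g2 [[a2 Lf2] [b2 Lg2] [M2 B2] U2 D2]]] := hinge_potentials p1 N0 ndh'.
have lip (f g : R -> R) a b : (forall x y, `|f x - f y| <= a * `|x - y|) ->
    (forall x y, `|g x - g y| <= b * `|x - y|) ->
    forall x y, `|f x + g (- x) - (f y + g (- y))| <= (a + b) * `|x - y|.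
  move=> fa gb x y; rewrite opprD addrACA mulrDl.
  apply: (le_trans (ler_normD _ _)); apply: lerD => //.
  by apply: (le_trans (gb _ _)); rewrite -opprD normrN.
exists (fun x => f1 x + f2 (- x)), (fun y => g1 y + g2 (- y)); split.
- by exists (a1 + a2); exact: lip.
- by exists (b1 + b2); exact: lip.
- exists (M1 + M2) => x; have [? ?] := B1 x; have [? ?] := B2 (- x).
  by split; apply: (le_trans (ler_normD _ _)); exact: lerD.
- move=> x y; rewrite addrACA -(hinge_sum p1) opprB.
  apply: lerD; first exact: U1.
  by have := U2 (- x) (- y); rewrite opprK addrC [in X in _ <= X]addrC.
- move=> x; rewrite addrACA -(hinge_sum p1) opprB.
  apply: lerD; first exact: D1.
  by have := D2 (- x); rewrite opprK !clipN opprK [X in hinge p X]addrC.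
Qed.

End dual_potentials.

(** * Weak duality and Lipschitz test functions *)

Section bounded_integrals.
Context {R : realType}.
Local Notation Rm := (measurableTypeR R).

Lemma lipschitz_continuous (f : R -> R) (L : R) :
  (forall x y, `|f x - f y| <= L * `|x - y|) -> continuous f.
Proof.
move=> fL x; apply/cvgrPdist_lt => e e0.
pose K := `|L| + 1; have K0 : 0 < K by rewrite ltr_wpDl.
have eK : 0 < e / K by rewrite divr_gt0.
near=> y; apply: (le_lt_trans (fL x y)); apply: (@le_lt_trans _ _ (K * `|x - y|)).
  by rewrite ler_wpM2r// (le_trans (ler_norm L))// lerDl.
rewrite mulrC -ltr_pdivlMr//; near: y; by exists (e / K).
Unshelve. all: by end_near. Qed.

Lemma integrable_bounded d (T : measurableType d) (Q : probability T R) (f : T -> R) (M : R) :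
  measurable_fun [set: T] f -> (forall x, `|f x| <= M) ->
  Q.-integrable [set: T] (EFin \o f).
Proof.
move=> mf fM; apply: measurable_bounded_integrable => //.
  by rewrite (le_lt_trans (probability_le1 _ _))// ltry.
by exists M; split; [exact: num_real|move=> z Mz x _ /=; rewrite (le_trans (fM x)) ?ltW].
Qed.

Lemma integral_marginal (Q : probability (Rm * Rm)%type R) (l : probability Rm R)
    (k : Rm * Rm -> Rm) (f : R -> R) (M : R) :
  measurable_fun [set: (Rm * Rm)%type] k ->
  (forall A : set Rm, measurable A -> Q (k @^-1` A) = l A) ->
  measurable_fun [set: Rm] (f : Rm -> Rm) -> (forall x, `|f x| <= M) ->
  (\int[Q]_z (f (k z))%:E = \int[l]_x (f x)%:E)%E.
Proof.
move=> mk kl mf fM.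
pose k' : {mfun (Rm * Rm)%type >-> Rm} := HB.pack k (isMeasurableFun.Build _ _ _ _ _ mk).
transitivity (\int[distribution Q k']_x (f x)%:E)%E; last first.
  by apply: eq_measure_integral => A mA _; exact: kl.
rewrite integral_distribution//; first exact/measurable_EFinP.
apply: (@integrable_bounded _ _ Q (f \o k) M); first exact: (measurableT_comp mf mk).
by move=> z; exact: fM.
Qed.

Lemma kantorovich_le (p M : R) (phi psi : R -> R) (l m : probability Rm R) :
  measurable_fun [set: Rm] (phi : Rm -> Rm) -> measurable_fun [set: Rm] (psi : Rm -> Rm) ->
  (forall x, `|phi x| <= M /\ `|psi x| <= M) ->
  (forall x y, phi x + psi y <= `|x - y| `^ p) ->
  (\int[l]_x (phi x)%:E + \int[m]_x (psi x)%:E <= wasserstein_pow p l m)%E.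
Proof.
move=> mphi mpsi bM le; apply: le_ereal_inf_tmp => _ [pi piC <-].
have b1 x : `|phi x| <= M by have [] := bM x.
have b2 x : `|psi x| <= M by have [] := bM x.
have m1 : measurable_fun [set: (Rm * Rm)%type] (fun z => phi z.1 : Rm).
  exact: (measurableT_comp mphi measurable_fst).
have m2 : measurable_fun [set: (Rm * Rm)%type] (fun z => psi z.2 : Rm).
  exact: (measurableT_comp mpsi measurable_snd).
have i1 : pi.-integrable [set: (Rm * Rm)%type] (EFin \o (fun z => phi z.1)).
  exact: (integrable_bounded _ m1 (fun z => b1 z.1)).
have i2 : pi.-integrable [set: (Rm * Rm)%type] (EFin \o (fun z => psi z.2)).
  exact: (integrable_bounded _ m2 (fun z => b2 z.2)).
have e1 : (\int[pi]_z (phi z.1)%:E = \int[l]_x (phi x)%:E)%E.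
  apply: (integral_marginal measurable_fst _ mphi b1) => A mA.
  by rewrite -(piC A mA).1; congr (pi _); apply/seteqP; split => z //= [].
have e2 : (\int[pi]_z (psi z.2)%:E = \int[m]_x (psi x)%:E)%E.
  apply: (integral_marginal measurable_snd _ mpsi b2) => A mA.
  by rewrite -(piC A mA).2; congr (pi _); apply/seteqP; split => z //= [].
rewrite -e1 -e2 -integralD_EFin//.
have id := integrableD measurableT i1 i2.
(* The cost may have infinite integral under pi. The positive part of the dual sum is integrable and
   still lies below the nonnegative cost. *)
apply: (@le_trans _ _ (\int[pi]_z ((fun z => (phi z.1)%:E + (psi z.2)%:E)^\+ z))%E).
  apply: le_integral => //; first exact: integrable_funepos.
  by move=> z _; rewrite funeposE le_max lexx.
apply: ge0_le_integral => //.
- by apply: measurable_funepos; case/integrableP : id.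
- apply: (measurableT_comp (measurable_abs_powR p)).
  by apply: measurable_funB; [exact: measurable_fst|exact: measurable_snd].
- move=> z _; rewrite funeposE ge_max -EFinD !lee_fin powR_ge0 andbT; exact: le.
Qed.

(** For z > e, write z = z^(1 - p) z^p and use 1 - p <= 0. This bounds a distance by its p-th power
    up to e, in place of Hoelder's inequality. *)
Lemma le_eps_powR (p e z : R) : 1 <= p -> 0 < e -> 0 <= z ->
  z <= e + e `^ (1 - p) * z `^ p.
Proof.
move=> p1 e0 z0; have [ze|ez] := leP z e.
  by rewrite (le_trans ze)// lerDl mulr_ge0 ?powR_ge0.
have z0' : 0 < z by exact: lt_trans ez.
apply: (@le_trans _ _ (e `^ (1 - p) * z `^ p)); last by rewrite lerDr ltW.
have pw (x r q : R) : 0 < x -> x `^ r * x `^ q = x `^ (r + q).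
  by move=> x0; rewrite powRD//; apply/implyP => _; rewrite gt_eqF.
have zp : z * z `^ (p - 1) = z `^ p.
  have := pw z 1 (p - 1) z0'; rewrite powRr1// => ->.
  by congr (_ `^ _); lra.
have ep : e `^ (1 - p) * e `^ (p - 1) = 1.
  by rewrite pw// (_ : _ + _ = 0) ?powRr0//; lra.
rewrite -zp mulrCA ler_peMr// -[leLHS]ep ler_wpM2l ?powR_ge0//.
by apply: ge0_ler_powR; rewrite ?subr_ge0// ?nnegrE// ltW.
Qed.

End bounded_integrals.

(** * Joint measurability *)

Section lipschitz_functionals.
Context {R : realType}.
Local Notation Rm := (measurableTypeR R).
Variables (p L M : R) (psi : R -> R).
Hypotheses (p1 : 1 <= p) (L0 : 0 < L).
Hypothesis psiL : forall x y, `|psi x - psi y| <= L * `|x - y|.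
Hypothesis psiM : forall x, `|psi x| <= M.

Lemma measurable_lipschitz : measurable_fun [set: Rm] (psi : Rm -> Rm).
Proof. by apply: continuous_measurable_fun; exact: lipschitz_continuous psiL. Qed.

Lemma integrable_lipschitz (m : probability Rm R) : m.-integrable [set: Rm] (EFin \o psi).
Proof. exact: (integrable_bounded _ measurable_lipschitz psiM). Qed.

(** Weak duality for the pair psi, - psi. Since psi x - psi y <= L |x - y| <= L e + K |x - y|^p,
    subtracting L e and dividing by K makes the pair admissible, so no optimal coupling is
    involved. *)
Lemma lipschitz_wasserstein_pow (e : R) (l m : probability Rm R) : 0 < e ->
  ((\int[l]_(x in [set: Rm]) psi x - \int[m]_(x in [set: Rm]) psi x)%:E <=
   (L * e)%:E + (L * e `^ (1 - p))%:E * wasserstein_pow p l m)%E.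
Proof.
move=> e0; pose K := L * e `^ (1 - p).
have K0 : 0 < K by rewrite mulr_gt0// powR_gt0.
pose phi x := K^-1 * (psi x - L * e); pose phi' x := K^-1 * (- psi x).
have mphi : measurable_fun [set: Rm] (phi : Rm -> Rm).
  by apply: measurable_funM => //; apply: measurable_funB => //; exact: measurable_lipschitz.
have mphi' : measurable_fun [set: Rm] (phi' : Rm -> Rm).
  apply: measurable_funM => //.
  exact: (measurableT_comp (@oppr_measurable R _) measurable_lipschitz).
have bd x : `|phi x| <= K^-1 * (M + L * e) /\ `|phi' x| <= K^-1 * (M + L * e).
  have Le0 : 0 <= L * e by rewrite mulr_ge0// ltW.
  rewrite !normrM (gtr0_norm (_ : 0 < K^-1)) ?invr_gt0// !ler_pM2l ?invr_gt0//.
  split; last by rewrite normrN (le_trans (psiM x))// lerDl.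
  by rewrite (le_trans (ler_normB _ _))// (ger0_norm Le0) lerD2r.
have le x y : phi x + phi' y <= `|x - y| `^ p.
  rewrite -mulrDr mulrC ler_pdivrMr//.
  have := le_trans (ler_norm _) (psiL x y); have := le_eps_powR p1 e0 (normr_ge0 (x - y)).
  move=> /(ler_wpM2l (ltW L0)); rewrite mulrDr mulrA -/K => h1 h2.
  rewrite [X in _ <= X]mulrC; lra.
have := kantorovich_le l m mphi mphi' bd le.
have i1 := integrable_lipschitz l; have i2 := integrable_lipschitz m.
have b1 x : `|phi x| <= K^-1 * (M + L * e) by have [] := bd x.
have b2 x : `|phi' x| <= K^-1 * (M + L * e) by have [] := bd x.
have fin (q : probability Rm R) (f : Rm -> R) : q.-integrable [set: Rm] (EFin \o f) ->
    (\int[q]_x (f x)%:E = (\int[q]_(x in [set: Rm]) f x)%:E)%E.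
  by move=> iq; rewrite fineK//; exact: integrable_fin_num.
rewrite (fin _ phi); last exact: (integrable_bounded _ mphi b1).
rewrite (fin _ phi'); last exact: (integrable_bounded _ mphi' b2).
have ic : l.-integrable [set: Rm] (EFin \o cst (L * e)).
  by apply: (@integrable_bounded _ _ _ l (cst (L * e)) `|L * e|).
have -> : \int[l]_(x in [set: Rm]) phi x = K^-1 * (\int[l]_(x in [set: Rm]) psi x - L * e).
  rewrite RintegralZl//; last exact: (integrableB measurableT i1 ic).
  rewrite RintegralB//; congr (_ * (_ - _)).
  apply: etrans (Rintegral_cst l measurableT _) _.
  exact: etrans (congr1 (fun c => L * e * fine c) (probability_setT l)) (mulr1 _).
have -> : \int[m]_(x in [set: Rm]) phi' x = K^-1 * (- \int[m]_(x in [set: Rm]) psi x).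
  have -> : phi' = fun x => (- K^-1) * psi x by apply/funext => x; rewrite /phi' mulrN mulNr.
  by rewrite RintegralZl// mulrN mulNr.
rewrite -EFinD -mulrDr => /(lee_wpmul2l (ltW K0 : 0%E <= K%:E)%E).
rewrite -EFinM mulrA divff ?gt_eqF// mul1r.
rewrite -leeBlDl//.
by apply: le_trans; rewrite -EFinB lee_fin; lra.
Qed.

End lipschitz_functionals.

Lemma cadlag_lipschitz {R : realType} (p L M : R) (psi : R -> R) (m : R -> probability (measurableTypeR R) R) t :
  1 <= p -> 0 < L -> (forall x y, `|psi x - psi y| <= L * `|x - y|) ->
  (forall x, `|psi x| <= M) -> cadlag_wasserstein p m ->
  0 <= t < 1 ->
  (\int[m s]_(x in [set: R]) psi x) @[s --> t^'+] --> \int[m t]_(x in [set: R]) psi x.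
Proof.
move=> p1 L0 psiL psiM cm t01; have [_ /(_ _ t01) cW _] := cm.
have p0 : 0 < p by exact: lt_le_trans p1.
apply/cvgrPdist_le => e e0.
(* r and q are chosen so that L r and K q are both e / 2. *)
pose r := e / (L *+ 2); have r0 : 0 < r by rewrite divr_gt0// mulrn_wgt0.
pose K := L * r `^ (1 - p); have K0 : 0 < K by rewrite mulr_gt0// powR_gt0.
pose q := e / (K *+ 2); have q0 : 0 < q by rewrite divr_gt0// mulrn_wgt0.
have q0' : 0 < q `^ p^-1 by rewrite powR_gt0.
have cWq := (cvge0P (fun s => poweR_ge0 (wasserstein_pow p (m s) (m t)) p^-1)).1 cW _ q0'.
near=> s.
have Wq : (wasserstein_pow p (m s) (m t) <= q%:E)%E.
  have : (wasserstein p (m s) (m t) <= (q `^ p^-1)%:E)%E.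
    by near: s; exact: cWq.
  rewrite /wasserstein; have := wasserstein_pow_ge0 p (m s) (m t).
  case: (wasserstein_pow p (m s) (m t)) => [a| |//].
    rewrite poweR_EFin !lee_fin => a0; rewrite !leNgt; apply: contra => qa.
    by apply: gt0_ltr_powR; rewrite ?invr_gt0// nnegrE ltW.
  by rewrite poweRyr ?invr_eq0 ?gt_eqF.
have bd : L * r + K * q = e.
  by rewrite /r /q; field; rewrite !gt_eqF.
have KW : ((L * r)%:E + K%:E * wasserstein_pow p (m s) (m t) <= e%:E)%E.
  rewrite -bd EFinD; apply: leeD => //; rewrite [(K * q)%:E]EFinM.
  by apply: lee_wpmul2l => //; rewrite lee_fin ltW.
rewrite distrC ler_norml -lee_fin -[(_ <= e)%R]lee_fin; apply/andP; split.
  (* The lower estimate is the upper one applied to - psi, with the two measures in the same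
     order. *)
  rewrite EFinN leeNl -EFinN opprB; apply: le_trans KW.
  have NE (l : probability (measurableTypeR R) R) :
      \int[l]_(x in [set: R]) (- psi x) = - \int[l]_(x in [set: R]) psi x.
    rewrite -[RHS]mulN1r -RintegralZl//; last exact: integrable_lipschitz psiL psiM l.
    by apply: eq_Rintegral => x _; rewrite mulN1r.
  have NL x y : `|- psi x - - psi y| <= L * `|x - y| by rewrite -opprD normrN psiL.
  have NM x : `|- psi x| <= M by rewrite normrN.
  have := lipschitz_wasserstein_pow p1 L0 NL NM (m s) (m t) r0.
  by rewrite !NE opprK addrC.
by apply: le_trans KW; exact: lipschitz_wasserstein_pow psiM _ _ _ _.
Unshelve. all: by end_near. Qed.

Section joint_measurability.
Context {R : realType} {d : measure_display} {T : measurableType d}.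
Local Notation Rm := (measurableTypeR R).
Variables (X : R -> T -> R) (N : set T).
Hypotheses (mN : measurable N).
Hypothesis mX : forall t, 0 <= t <= 1 -> measurable_fun [set: T] (X t : T -> Rm).
Hypothesis rcX : forall o t, ~ N o -> 0 <= t < 1 -> X s o @[s --> t^'+] --> X t o.

Let grid (n j : nat) : R := Num.min (j.+1%:R / n.+1%:R) 1.

Let grid01 n j : 0 <= grid n j <= 1.
Proof. by rewrite /grid ge_min lexx orbT andbT le_min ler01 andbT divr_ge0. Qed.

(** For t < 1 this time is strictly after t, hence the successor in [grid]: a limit along [t^'+]
    does not see t itself. At t = 1 the cap returns 1. *)
Let next n (t : R) := grid n (Num.truncn (t * n.+1%:R)).

Let cvg_next t : 0 <= t -> t < 1 ->
  (forall n, next n t > t) /\ next n t @[n --> \oo] --> t.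
Proof.
move=> t0 t1; have n0 n : 0 < n.+1%:R :> R by [].
have gt n : next n t > t.
  by rewrite lt_min t1 andbT ltr_pdivlMr// truncnS_gt.
have le n : next n t <= t + n.+1%:R^-1.
  rewrite ge_min; apply/orP; left; rewrite ler_pdivrMr// mulrDl mulVf ?gt_eqF//.
  by rewrite -natr1 lerD2r truncn_le mulr_ge0.
split=> //; apply: (@squeeze_cvgr _ _ _ _ (cst t) (fun n => t + n.+1%:R^-1)).
- by apply: nearW => n; rewrite (ltW (gt n)) le.
- exact: cvg_cst.
- rewrite -[X in _ --> X]addr0; apply: cvgD; first exact: cvg_cst.
  exact: cvg_harmonic.
Qed.

Let D : set (Rm * T)%type := `[0, 1]%classic `*` ~` N.

Let mD : measurable D.
Proof. by apply: measurableX => //; exact: measurableC. Qed.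

Let measurable_next n :
  measurable_fun D (fun z => X (next n z.1) z.2 : Rm).
Proof.
move=> _ U mU.
have -> : D `&` (fun z => X (next n z.1) z.2) @^-1` U =
    D `&` \bigcup_j (`[j%:R / n.+1%:R, j.+1%:R / n.+1%:R[%classic `*` (X (grid n j) @^-1` U)).
  apply/seteqP; split=> -[t o] [/= Dto].
    move=> Ut; split=> //; exists (Num.truncn (t * n.+1%:R)) => //; split=> //=.
    have := Dto.1; rewrite /= !in_itv/= => /andP[t0 _].
    rewrite ler_pdivrMr// ltr_pdivlMr// truncnS_gt andbT truncn_le.
    by rewrite mulr_ge0.
  move=> [j _ [/= + Uj]]; rewrite in_itv/= ler_pdivrMr// ltr_pdivlMr// => tj; split => //.
  by rewrite /next (truncn_def tj).
apply: measurableI => //; apply: bigcupT_measurable => j; apply: measurableX => //.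
by rewrite -[X in measurable X]setTI; exact: (mX (grid01 n j)).
Qed.

(** By right continuity X is the limit of X sampled at [next n t], which on each mesh cell depends
    on t only through the cell. Setting it to 0 off D gives measurability on the whole product. *)
Lemma jointly_measurable : exists2 X' : Rm * T -> Rm,
  measurable_fun [set: (Rm * T)%type] X' &
  forall t o, 0 <= t <= 1 -> ~ N o -> X' (t, o) = X t o.
Proof.
pose X1 (z : Rm * T) : Rm := X z.1 z.2.
have mX1 : measurable_fun D X1.
  apply: (measurable_fun_cvg measurable_next) => -[t o] [/= + No].
  rewrite in_itv/= => /andP[t0]; rewrite le_eqVlt => /predU1P[->|t1].
    have n1 n : next n 1 = 1.
      apply/min_idPr; rewrite ler_pdivlMr// mul1r ler_nat ltnS truncn_ge_nat ?mul1r//.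
      by rewrite ler_nat.
    have -> : (fun n => X (next n 1) o) = (fun=> X 1 o) by apply/funext => n; rewrite n1.
    exact: cvg_cst.
  have [gt cv] := cvg_next t0 t1.
  have t01 : 0 <= t < 1 by rewrite t0.
  exact: ((cvg_at_rightP (X ^~ o) t (X t o)).1 (rcX No t01)).
exists (X1 \_ D); first exact: (measurable_restrictT _ mD).1.
by move=> t o t01 No; rewrite patchE mem_set.
Qed.

End joint_measurability.

Section expectation.
Context {R : realType} {d : measure_display} {T : measurableType d}.
Variables (P : probability T R) (F : R -> set (set T)) (B : R -> T -> R).
Local Notation Rm := (measurableTypeR R).
Local Notation gam := (@gam R).
Hypothesis filtF : filtration F.
Hypothesis bmB : brownian_motion P F B.

Lemma expectation_gint (g : R -> \bar R) t : 0 <= t <= 1 ->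
  measurable_fun [set: Rm] g -> (forall x, 0 <= g x)%E ->
  (\int[P]_o gint g t (B t o) = \int[gam]_z g z)%E.
Proof.
move=> t01 mg g0; have [_ B0 _ _ _] := bmB.
have FT s : 0 <= s <= 1 -> F s [set: T].
  by move=> s01; have [/(_ s s01)[[F0 FC _] _] _] := filtF; rewrite -[setT]setD0; exact: FC.
have t00 : 0 <= (0 : R) <= 1 by rewrite lexx/=.
apply: etrans (esym (markov_gaussian filtF bmB t01 (FT _ t01) mg g0)) _.
apply: etrans (markov_gaussian filtF bmB t00 (FT _ t00) mg g0) _.
under eq_integral do rewrite B0.
apply: etrans (integral_cst_probability _ _) _.
by rewrite /gint /sdev subr0 sqrtr1 aff01.
Qed.

End expectation.

(** * Bounds on the weighted cost *)

Section weights.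
Context {R : realType} {d : measure_display} {T : measurableType d}.
Local Notation Rm := (measurableTypeR R).
Local Notation leb := (@lebesgue_measure R).
Variables (P : probability T R) (w : R -> R).
Hypothesis mw : measurable_fun (`[0, 1] : set R) w.
Hypothesis w0 : forall t, 0 <= t <= 1 -> 0 <= w t.
Local Open Scope ereal_scope.

Let I01 : set Rm := `[0%R, 1%R]%classic.

Lemma integral_weight_le (N : set T) (f g : Rm -> T -> \bar R) :
  measurable N -> P N = 0 ->
  (forall t o, (0 <= t <= 1)%R -> 0 <= f t o) -> (forall t o, (0 <= t <= 1)%R -> 0 <= g t o) ->
  (forall t o, (0 <= t <= 1)%R -> ~ N o -> f t o <= g t o) ->
  \int[P]_o \int[leb]_(t in I01) ((w t)%:E * f t o) <=
  \int[P]_o \int[leb]_(t in I01) ((w t)%:E * g t o).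
Proof.
move=> mN N0 f0 g0 fg.
have wf0 (k : Rm -> T -> \bar R) t o : (forall t o, (0 <= t <= 1)%R -> 0 <= k t o) ->
    I01 t -> 0 <= (w t)%:E * k t o.
  by rewrite /I01/= in_itv => k0 t01; rewrite mule_ge0 ?lee_fin ?w0// k0.
apply: (le_integral_ae_nonmeasurable mN N0) => o _.
- by apply: integral_ge0 => t; exact: wf0.
- by apply: integral_ge0 => t; exact: wf0.
move=> No; apply: (le_integral_ae_nonmeasurable measurable0 (measure0 _)) => t.
- exact: wf0.
- exact: wf0.
- rewrite /I01/= in_itv/= => t01 _; apply: lee_wpmul2l; last exact: fg.
  by rewrite lee_fin w0.
Qed.

Lemma integral_weight_tonelli (Z : Rm * T -> \bar R) :
  measurable_fun [set: (Rm * T)%type] Z -> (forall z, 0 <= Z z) ->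
  \int[P]_o \int[leb]_(t in I01) ((w t)%:E * Z (t, o)) =
  \int[leb]_(t in I01) ((w t)%:E * \int[P]_o Z (t, o)).
Proof.
(* w is measurable on [0, 1] only; its extension by 0 lets Tonelli be applied on the whole line. *)
move=> mZ Z0; pose v : Rm -> \bar R := (EFin \o w) \_ I01.
have mI : measurable I01 by exact: measurable_itv.
have mv : measurable_fun [set: Rm] v.
  by apply/(measurable_restrictT _ mI)/measurable_EFinP.
have v0 t : 0 <= v t.
  apply: erestrict_ge0 => {}t; rewrite /I01/= in_itv => t01.
  by rewrite lee_fin w0.
have vE (k : Rm -> \bar R) : \int[leb]_(t in I01) ((w t)%:E * k t) = \int[leb]_t (v t * k t).
  apply: etrans (integral_mkcond _ _) _; apply: eq_integral => t _.
  by rewrite /v !patchE; case: ifPn => // _; rewrite mul0e.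
transitivity (\int[P]_o \int[leb]_t (v t * Z (t, o))).
  by apply: eq_integral => o _; exact: vE.
have mvZ : measurable_fun [set: (Rm * T)%type] (fun z => v z.1 * Z z).
  by apply: emeasurable_funM => //; exact: (measurableT_comp mv measurable_fst).
have vZ0 z : 0 <= v z.1 * Z z by exact: mule_ge0.
transitivity (\int[leb]_t \int[P]_o (v t * Z (t, o))).
  have E := @fubini_tonelli _ _ _ _ _ leb P _ mvZ vZ0.
  exact: esym E.
apply: etrans _ (esym (vE _)); apply: eq_integral => t _ /=.
apply: ge0_integralZl => //.
exact: measurableT_comp mZ (pair1_measurable t).
Qed.

Lemma integral_weight_const (c : \bar R) : 0 <= c ->
  \int[leb]_(t in I01) ((w t)%:E * c) = \int[leb]_(t in I01) (w t)%:E * c.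
Proof.
move=> c0; apply: ge0_integralZr => //.
- exact: measurable_itv.
- exact/measurable_EFinP.
Qed.

End weights.

Section cost_bounds.
Context {R : realType} {d : measure_display} {T : measurableType d}.
Local Notation Rm := (measurableTypeR R).
Local Notation gam := (@gam R).
Local Notation leb := (@lebesgue_measure R).
Variables (P : probability T R) (F : R -> set (set T)) (B : R -> T -> R).
Hypothesis filtF : filtration F.
Hypothesis bmB : brownian_motion P F B.
Variables (mu : probability Rm R) (p : R).
Variable w : R -> R.
Hypothesis mw : measurable_fun (`[0, 1] : set R) w.
Hypothesis w0 : forall t, 0 <= t <= 1 -> 0 <= w t.
Local Notation h := (bass_map mu).
Local Notation weight := (\int[leb]_(t in `[0%R, 1%R]%classic) (w t)%:E)%E.

Lemma brownian_right_continuous o t : {within `[0, 1], continuous (B ^~ o)} ->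
  0 <= t < 1 -> B s o @[s --> t^'+] --> B t o.
Proof.
move=> cB /andP[t0 t1]; have /continuous_within_itvP := cB => /(_ ltr01) [ci c0 _].
move: t0; rewrite le_eqVlt => /predU1P[<-//|t0].
by apply: cvg_at_right_filter; apply: ci; rewrite in_itv/= t0.
Qed.

Lemma jointly_measurable_brownian (N : set T) : measurable N ->
  (forall o, ~ N o -> {within `[0, 1], continuous (B ^~ o)}) ->
  exists2 B' : Rm * T -> Rm, measurable_fun [set: (Rm * T)%type] B' &
    forall t o, 0 <= t <= 1 -> ~ N o -> B' (t, o) = B t o.
Proof.
move=> mN cB; apply: jointly_measurable => //.
  by move=> t; exact: (brownian_measurable filtF bmB).
by move=> o t /cB; exact: brownian_right_continuous.
Qed.

Lemma eq_integral_off (N : set T) (f g : T -> \bar R) : measurable N -> P N = 0%E ->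
  measurable_fun [set: T] f -> measurable_fun [set: T] g ->
  (forall o, ~ N o -> f o = g o) -> (\int[P]_o f o = \int[P]_o g o)%E.
Proof.
move=> mN N0 mf mg fg; apply: ae_eq_integral => //.
exists N; split=> // o /=; apply: contra_notP => No _; exact: fg.
Qed.

Lemma weighted_cost_bass_le :
  (weighted_cost P p w (eta B) (bass_mvm mu B) <=
   weight * \int[gam]_z (`|z - h z| `^ p)%:E)%E.
Proof.
have [_ _ [N [mN N0 cN]] _ _] := bmB.
have cB o : ~ N o -> {within `[0, 1], continuous (B ^~ o)}.
  by move=> No; apply: contrapT => H; apply: No; apply: cN.
have [B' mB' BB'] := jointly_measurable_brownian mN cB.
pose c (x : R) : \bar R := (`|x - h x| `^ p)%:E.
have c0 x : (0 <= c x)%E by rewrite lee_fin powR_ge0.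
have mc : measurable_fun [set: Rm] c.
  apply: (measurableT_comp (measurable_abs_powR p)).
  by apply: measurable_funB => //; exact: measurable_bass_map.
(* B is measurable at each fixed time; its jointly measurable version [B'] makes the majorant Z
   accessible to Tonelli. *)
pose Z (z : Rm * T) := gint c z.1 (B' z).
have mZ : measurable_fun [set: (Rm * T)%type] Z.
  have mtB : measurable_fun [set: (Rm * T)%type] (fun z => (z.1, B' z) : (Rm * Rm)%type).
    by apply: measurable_fun_pair => //; exact: measurable_fst.
  exact: (measurableT_comp (measurable_gint2 mc c0) mtB).
have Z0 z : (0 <= Z z)%E by exact: gint_ge0.
apply: (@le_trans _ _ (\int[P]_o \int[leb]_(t in `[0%R, 1%R]%classic) ((w t)%:E * Z (t, o)))%E).
  apply: (integral_weight_le w0 mN N0 (fun t o _ => wasserstein_pow_ge0 p (eta B t o) (bass_mvm mu B t o)) (fun t o _ => Z0 (t, o))).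
  move=> t o t01 No; rewrite /Z/= BB'//.
  apply: (@wasserstein_pow_le R _ _ gam p (gpath (B ^~ o) t) (fun z => h (gpath (B ^~ o) t z))).
  - exact: measurable_gpath.
  - exact: (measurableT_comp (measurable_bass_map mu) (measurable_gpath (B ^~ o) t)).
  - by move=> A mA; exact: eta_gam.
  - by move=> A mA; exact: bass_mvm_gpath.
rewrite le_eqVlt; apply/orP; left; apply/eqP.
apply: etrans (integral_weight_tonelli P mw w0 mZ Z0) _.
have EZ t : 0 <= t <= 1 -> (\int[P]_o Z (t, o) = \int[gam]_z c z)%E.
  move=> t01; rewrite -(expectation_gint filtF bmB t01 mc c0).
  apply: (eq_integral_off mN N0).
  - exact: (measurableT_comp mZ (pair1_measurable t)).
  - exact: (measurableT_comp (measurable_gint t mc c0) (brownian_measurable filtF bmB t01)).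
  - by move=> o No; rewrite /Z/= BB'.
apply: etrans _ (integral_weight_const mw w0 _); last by apply: integral_ge0.
by apply: eq_integral => t; rewrite inE/= in_itv/= => t01; rewrite EZ.
Qed.

End cost_bounds.

(** * Lower bound for an arbitrary measure-valued martingale *)

Section lower_bound.
Context {R : realType} {d : measure_display} {T : measurableType d}.
Local Notation Rm := (measurableTypeR R).
Local Notation gam := (@gam R).
Local Notation leb := (@lebesgue_measure R).
Variables (P : probability T R) (F : R -> set (set T)) (B : R -> T -> R).
Hypothesis filtF : filtration F.
Hypothesis bmB : brownian_motion P F B.
Variables (mu : probability Rm R) (p : R).
Hypothesis p1 : 1 <= p.
Variable w : R -> R.
Hypothesis mw : measurable_fun (`[0, 1] : set R) w.
Hypothesis w0 : forall t, 0 <= t <= 1 -> 0 <= w t.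
Local Notation weight := (\int[leb]_(t in `[0%R, 1%R]%classic) (w t)%:E)%E.
Variable xi : R -> T -> probability Rm R.
Hypothesis mvmxi : mvm_from P F p mu xi.

Variables (phi psi : R -> R) (L M : R).
Hypothesis L0 : 0 < L.
Hypothesis phiL : forall x y, `|phi x - phi y| <= L * `|x - y|.
Hypothesis psiL : forall x y, `|psi x - psi y| <= L * `|x - y|.
Hypothesis phi0 : forall x, 0 <= phi x.
Hypothesis boundM : forall x, `|phi x| <= M /\ `|psi x| <= M.
Hypothesis dual : forall x y, phi x + psi y <= `|x - y| `^ p.

Let X t o := \int[xi t o]_(x in [set: Rm]) psi x.

Let phiM x : `|phi x| <= M. Proof. by have [] := boundM x. Qed.
Let psiM x : `|psi x| <= M. Proof. by have [] := boundM x. Qed.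
Let mphi : measurable_fun [set: Rm] (EFin \o phi : Rm -> \bar R).
Proof. apply/measurable_EFinP; exact: measurable_lipschitz phiL. Qed.
Let phiE0 x : (0 <= (EFin \o phi) x)%E.
Proof. by rewrite lee_fin. Qed.

Let martX : martingale P F X.
Proof.
have [[_ _ mart] _ _] := mvmxi.
by apply: mart; [exact: lipschitz_continuous psiL|exists M].
Qed.

Let mX t : 0 <= t <= 1 -> measurable_fun [set: T] (X t : T -> Rm).
Proof.
move=> t01 _ U mU; rewrite setTI; have [adX _ _] := martX.
by apply: (filtration_measurable filtF t01); exact: adX.
Qed.

Let XE t o : ((X t o)%:E = \int[xi t o]_x (psi x)%:E)%E.
Proof. by apply: fineK; apply: integrable_fin_num => //; exact: integrable_lipschitz psiL psiM _. Qed.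

Let expectation_X t : 0 <= t <= 1 -> (\int[P]_o (X t o)%:E = \int[mu]_x (psi x)%:E)%E.
Proof.
move=> /andP[t0 t1]; have [_ _ eqX] := martX; have [_ _ [N [mN N0 xN]]] := mvmxi.
have t00 : 0 <= (0 : R) <= 1 by rewrite lexx/=.
have FT : F 0 [set: T].
  by have [/(_ 0 t00)[[F0 FC _] _] _] := filtF; rewrite -[setT]setD0; exact: FC.
apply: etrans (eqX _ _ (lexx _) t0 t1 _ FT) _.
rewrite -[RHS](integral_cst_probability P); apply: (eq_integral_off mN N0) => //.
  by apply/measurable_EFinP; exact: mX.
move=> o No; apply: etrans (XE 0 o) _; apply: eq_measure_integral => A mA _.
by apply: contrapT => H; apply: No; apply: xN => /= xiA; apply: H; exact: xiA.
Qed.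

Lemma weighted_cost_ge_dual (C : \bar R) : (0 <= C)%E ->
  (C <= \int[gam]_x (phi x)%:E + \int[mu]_x (psi x)%:E)%E ->
  (weight * C <= weighted_cost P p w (eta B) xi)%E.
Proof.
move=> C0 CE; have [_ _ aeB _ _] := bmB; have [_ aexi _] := mvmxi.
have [N [mN N0 cN]] := filterI aeB aexi.
have cB o : ~ N o -> {within `[0, 1], continuous (B ^~ o)} /\ cadlag_wasserstein p (xi ^~ o).
  by move=> No; apply: contrapT => H; apply: No; apply: cN.
have [B' mB' BB'] := jointly_measurable_brownian filtF bmB mN (fun o No => (cB o No).1).
have [|X' mX' XX'] := jointly_measurable mN mX.
  by move=> o t /cB[_ co]; exact: cadlag_lipschitz psiL psiM co.
pose Y (z : Rm * T) := (gint (EFin \o phi) z.1 (B' z) + (X' z)%:E)%E.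
have mY : measurable_fun [set: (Rm * T)%type] Y.
  have mtB : measurable_fun [set: (Rm * T)%type] (fun z => (z.1, B' z) : (Rm * Rm)%type).
    by apply: measurable_fun_pair => //; exact: measurable_fst.
  apply: emeasurable_funD; last exact/measurable_EFinP.
  exact: (measurableT_comp (measurable_gint2 mphi phiE0) mtB).
(* Y may be negative. Its positive part is still below the nonnegative W_p^p and has at least the
   same mean. *)
pose Z := (Y^\+)%E.
have mZ : measurable_fun [set: (Rm * T)%type] Z by exact: measurable_funepos.
have Z0 z : (0 <= Z z)%E by exact: funepos_ge0.
have YE t o : 0 <= t <= 1 -> ~ N o -> Y (t, o) = (gint (EFin \o phi) t (B t o) + (X t o)%:E)%E.
  by move=> t01 No; rewrite /Y/= BB'// XX'.
have CZ t : 0 <= t <= 1 -> (C <= \int[P]_o Z (t, o))%E.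
  move=> t01; apply: (le_trans CE).
  have iphi : gam.-integrable [set: Rm] (EFin \o phi).
    exact: (integrable_lipschitz phiL phiM).
  have mG : measurable_fun [set: T] (fun o => gint (EFin \o phi) t (B t o)).
    exact: (measurableT_comp (measurable_gint t mphi phiE0) (brownian_measurable filtF bmB t01)).
  have EG := expectation_gint filtF bmB t01 mphi phiE0.
  have iG : P.-integrable [set: T] (fun o => gint (EFin \o phi) t (B t o)).
    apply/integrableP; split => //.
    have -> : (\int[P]_o `|gint (EFin \o phi) t (B t o)| = \int[gam]_z (EFin \o phi) z)%E.
      by rewrite -EG; apply: eq_integral => o _; rewrite gee0_abs// gint_ge0.
    have /integrableP[_] := iphi; apply: le_lt_trans.
    by rewrite le_eqVlt; apply/orP; left; apply/eqP; apply: eq_integral => z _; rewrite gee0_abs.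
  have [_ /(_ _ t01) iX _] := martX.
  have iGX := integrableD measurableT iG iX.
  have -> : (\int[gam]_x (phi x)%:E + \int[mu]_x (psi x)%:E =
      \int[P]_o (gint (EFin \o phi) t (B t o) + (X t o)%:E))%E.
    by rewrite -(expectation_X t01) -EG; apply/esym/integralD.
  apply: (@le_trans _ _ (\int[P]_o (fun o => gint (EFin \o phi) t (B t o) + (X t o)%:E)^\+ o)%E).
    apply: le_integral => //; first exact: integrable_funepos.
    by move=> o _; rewrite funeposE le_max lexx.
  rewrite le_eqVlt; apply/orP; left; apply/eqP; apply: (eq_integral_off mN N0).
  - by apply: measurable_funepos; case/integrableP : iGX.
  - exact: (measurableT_comp mZ (pair1_measurable t)).
  - by move=> o No; rewrite /Z !funeposE YE.
apply: (@le_trans _ _ (\int[P]_o \int[leb]_(t in `[0%R, 1%R]%classic) ((w t)%:E * Z (t, o)))%E); last first.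
  apply: (integral_weight_le w0 mN N0 (fun t o _ => Z0 (t, o)) (fun t o _ => wasserstein_pow_ge0 p (eta B t o) (xi t o))).
  move=> t o t01 No; rewrite /Z funeposE YE// ge_max wasserstein_pow_ge0 andbT.
  rewrite XE -(integral_eta B o t01 mphi phiE0).
  apply: kantorovich_le boundM dual; first exact: measurable_lipschitz phiL.
  exact: measurable_lipschitz psiL.
apply: (@le_trans _ _ (\int[leb]_(t in `[0%R, 1%R]%classic) ((w t)%:E * \int[P]_o Z (t, o)))%E); last first.
  by rewrite le_eqVlt; apply/orP; left; apply/eqP/esym/integral_weight_tonelli.
apply: le_trans (_ : (_ <= \int[leb]_(t in `[0%R, 1%R]%classic) ((w t)%:E * C))%E) _.
  by rewrite le_eqVlt; apply/orP; left; apply/eqP/esym/integral_weight_const.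
apply: (le_integral_ae_nonmeasurable measurable0 (measure0 _)) => t.
- by rewrite /= in_itv/= => t01; rewrite mule_ge0// lee_fin w0.
- by rewrite /= in_itv/= => t01; rewrite mule_ge0 ?lee_fin ?w0// integral_ge0.
- rewrite /= in_itv/= => t01 _; apply: lee_wpmul2l; last exact: CZ.
  by rewrite lee_fin w0.
Qed.

End lower_bound.

Section cost_lower_bound.
Context {R : realType} {d : measure_display} {T : measurableType d}.
Local Notation Rm := (measurableTypeR R).
Local Notation gam := (@gam R).
Local Notation leb := (@lebesgue_measure R).
Variables (P : probability T R) (F : R -> set (set T)) (B : R -> T -> R).
Hypothesis filtF : filtration F.
Hypothesis bmB : brownian_motion P F B.
Variables (mu : probability Rm R) (p : R).
Hypothesis p1 : 1 <= p.
Variable w : R -> R.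
Hypothesis mw : measurable_fun (`[0, 1] : set R) w.
Hypothesis w0 : forall t, 0 <= t <= 1 -> 0 <= w t.
Local Notation h := (bass_map mu).
Local Notation weight := (\int[leb]_(t in `[0%R, 1%R]%classic) (w t)%:E)%E.
Variable xi : R -> T -> probability Rm R.
Hypothesis mvmxi : mvm_from P F p mu xi.

Let clip_cost (n x : R) : \bar R := (`|clip n x - clip n (h x)| `^ p)%:E.

Let measurable_clip_cost n : measurable_fun [set: Rm] (clip_cost n : Rm -> \bar R).
Proof.
apply: (measurableT_comp (measurable_abs_powR p)).
have mc : measurable_fun [set: Rm] (clip n : Rm -> Rm).
  by apply: continuous_measurable_fun; exact: continuous_clip.
by apply: measurable_funB => //; exact: (measurableT_comp mc (measurable_bass_map mu)).
Qed.

Lemma weighted_cost_ge_clip (n : R) : 0 <= n ->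
  (weight * \int[gam]_z (`|clip n z - clip n (h z)| `^ p)%:E <=
   weighted_cost P p w (eta B) xi)%E.
Proof.
move=> n0; have [f [g [[L1 fL] [L2 gL] [M bM] fg fgh]]] :=
  dual_potentials p1 n0 (@nondecreasing_bass_map R mu).
have M0 : 0 <= M by apply: le_trans (normr_ge0 (f 0)) (bM 0).1.
(* One Lipschitz constant for both potentials; the summand 1 makes it positive. *)
pose L := `|L1| + `|L2| + 1; have L0 : 0 < L by rewrite ltr_wpDl// addr_ge0.
(* Opposite shifts keep phi x + psi y unchanged and make phi nonnegative, as [gint] requires. *)
pose phi x := f x + M; pose psi x := g x - M.
have phiL x y : `|phi x - phi y| <= L * `|x - y|.
  rewrite (_ : phi x - phi y = f x - f y); last by rewrite /phi; ring.
  apply: (le_trans (fL x y)); apply: ler_wpM2r => //.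
  by rewrite (le_trans (ler_norm _))// /L -addrA lerDl addr_ge0.
have psiL x y : `|psi x - psi y| <= L * `|x - y|.
  rewrite (_ : psi x - psi y = g x - g y); last by rewrite /psi; ring.
  apply: (le_trans (gL x y)); apply: ler_wpM2r => //.
  by rewrite (le_trans (ler_norm _))// /L addrAC lerDr addr_ge0.
have phi0 x : 0 <= phi x.
  by have [+ _] := bM x; rewrite ler_norml -lerBlDr sub0r => /andP[].
have b x : `|phi x| <= M + M /\ `|psi x| <= M + M.
  have [fM gM] := bM x; split.
    by apply: (le_trans (ler_normD _ _)); rewrite (ger0_norm M0) lerD2r.
  by apply: (le_trans (ler_normB _ _)); rewrite (ger0_norm M0) lerD2r.
have dual x y : phi x + psi y <= `|x - y| `^ p.
  by rewrite (_ : phi x + psi y = f x + g y)//; rewrite /phi /psi; ring.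
apply: (weighted_cost_ge_dual filtF bmB p1 mw w0 mvmxi L0 phiL psiL phi0 b dual).
  by apply: integral_ge0 => z _; rewrite lee_fin powR_ge0.
have b1 x : `|phi x| <= M + M by have [] := b x.
have b2 x : `|psi x| <= M + M by have [] := b x.
have mpsi := measurable_lipschitz psiL.
have mpsih : measurable_fun [set: Rm] (fun z => psi (h z) : Rm).
  exact: (measurableT_comp mpsi (measurable_bass_map mu)).
have i1 := integrable_lipschitz phiL b1 gam.
have i2 : gam.-integrable [set: Rm] (EFin \o (fun z => psi (h z))).
  exact: (integrable_bounded _ mpsih (fun z => b2 (h z))).
have <- : (\int[gam]_z (psi (h z))%:E = \int[mu]_x (psi x)%:E)%E.
  transitivity (\int[distribution gam h]_x (psi x)%:E)%E.
    by apply/esym/integral_distribution => //; exact/measurable_EFinP.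
  by apply: eq_measure_integral => A mA _; exact: bass_map_distribution.
rewrite -integralD_EFin//; have [mi _] := integrableP _ _ _ (integrableD measurableT i1 i2).
apply: ge0_le_integral => //.
- exact: measurable_clip_cost.
- by move=> z _; rewrite /= -EFinD lee_fin (_ : phi z + _ = f z + g (h z))// /phi /psi; ring.
Qed.

Lemma weighted_cost_ge :
  (weight * \int[gam]_z (`|z - h z| `^ p)%:E <= weighted_cost P p w (eta B) xi)%E.
Proof.
have wt0 : (0 <= weight)%E.
  by apply: integral_ge0 => t; rewrite /= in_itv/= => t01; rewrite lee_fin w0.
have m : measurable_fun [set: Rm] (fun z : Rm => (`|z - h z| `^ p)%:E).
  apply: (measurableT_comp (measurable_abs_powR p)).
  by apply: measurable_funB => //; exact: measurable_bass_map.
have c0 n z : (0 <= clip_cost n z)%E by rewrite lee_fin powR_ge0.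
(* The weight may be infinite, so it is moved under the integral before Fatou. For fixed z the
   clipped cost equals the true one as soon as n exceeds [|z|] and [|h z|], so the product is
   eventually constant in n. *)
rewrite -ge0_integralZl//.
apply: (@fatou_le _ _ _ gam (fun n z => weight * clip_cost n%:R z)%E).
- by move=> n; apply: measurable_funeM; exact: measurable_clip_cost.
- exact: measurable_funeM.
- by move=> n z; rewrite mule_ge0.
- apply: aeW => z; apply: cvg_near_cst; near=> n.
  have zn : `|z| <= n%:R by near: n; exact: nbhs_infty_ger.
  have hn : `|h z| <= n%:R by near: n; exact: nbhs_infty_ger.
  by rewrite /clip_cost !clip_id.
- move=> n; rewrite ge0_integralZl//; exact: weighted_cost_ge_clip.
Unshelve. all: by end_near. Qed.

End cost_lower_bound.

Theorem theorem4p2 (R : realType) (d : measure_display) (T : measurableType d)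
    (P : probability T R) (F : R -> set (set T)) (B : R -> T -> R)
    (p : R) (mu : probability (measurableTypeR R) R) :
  filtration F -> usual_conditions P F -> brownian_motion P F B ->
  1 <= p -> finite_moment p mu -> no_atom mu ->
  mvm_from P F p mu (bass_mvm mu B) /\
  forall w : R -> R,
    measurable_fun (`[0, 1] : set R) w -> (forall t, 0 <= t <= 1 -> 0 <= w t) ->
  forall xi : R -> T -> probability (measurableTypeR R) R,
    mvm_from P F p mu xi ->
    (weighted_cost P p w (eta B) (bass_mvm mu B) <=
     weighted_cost P p w (eta B) xi)%E.
Proof.
move=> filtF _ bmB p1 pmu _; split; first exact: mvm_from_bass.
move=> w mw w0 xi mvmxi.
apply: le_trans (weighted_cost_ge filtF bmB p1 mw w0 mvmxi).
exact: (weighted_cost_bass_le filtF bmB mu p mw w0).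
Qed.
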